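(* Let $k\geq 3$. There exist marked groups $\Gamma_k$ and $\Delta_k$ with isomorphic Cayley graphs such that (i) $\chi_B(F(2^{\Gamma_k})) = \chi_{BM}(F(2^{\Gamma_k})) = \chi_M(F(2^{\Gamma_k})) = \chi(F(2^{\Gamma_k})) = \chi(F(2^{\Delta_k})) = \chi(\mathrm{Cay}(\Gamma_k)) = \chi(\mathrm{Cay}(\Delta_k)) = k$, and (ii) $\chi_B(F(2^{\Delta_k})) = \chi_{BM}(F(2^{\Delta_k})) = \chi_M(F(2^{\Delta_k})) = k+1$.
   Context: A marked group is a finitely generated group $\Gamma$ with a finite symmetric generating set $S$ not containing the identity; its Cayley graph $\mathrm{Cay}(\Gamma)$ has vertex set $\Gamma$ with $g$ adjacent to $sg$ for $s\in S$. The left shift action of $\Gamma$ on $2^\Gamma$ is $(g\cdot x)(h)=x(g^{-1}h)$; its free part is the $G_\delta$ (hence Polish) set $F(2^\Gamma)=\{x\in 2^\Gamma : g\cdot x\neq x \text{ for all } g\neq \mathrm{id}\}$. The shift graph $F(2^\Gamma)$ is the graph on this free part joining distinct $x,y$ iff $s\cdot x=y$ for some $s\in S$. For a Borel graph $G$ on a Polish space $X$: $\chi(G)$ is the chromatic number; $\chi_B(G)$ is the least $k$ with a Borel $k$-coloring; $\chi_{BM}(G)$ is the least $k$ with a Baire measurable $k$-coloring; for a Borel probability measure $\mu$ on $X$, $\chi_\mu(G)$ is the least $k$ with a $\mu$-measurable $k$-coloring, and $\chi_M(G)=\sup_\mu \chi_\mu(G)$ over all Borel probability measures $\mu$ on $X$.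 *)

(* Defs.v *)
From HB Require Import structures.
From mathcomp Require Import all_boot all_order all_algebra.
From mathcomp Require Import all_classical all_reals all_analysis.

Set Implicit Arguments.
Unset Strict Implicit.
Unset Printing Implicit Defensive.

Import Order.TTheory GRing.Theory Num.Theory.
Local Open Scope classical_set_scope.

(* Finiteness of the generating set is built into its being a sequence; since
   it is symmetric, generation means that every element is a product of
   generators. *)
Record markedGroup := MarkedGroup {
  mg_group :> groupType;
  mg_gens : seq mg_group;
  mg_gens_sym : forall s, s \in mg_gens -> s^-1%g \in mg_gens;
  mg_gens_neq1 : 1%g \notin mg_gens;
  mg_gens_generate : forall g : mg_group, exists2 w : seq mg_group,
    {subset w <= mg_gens} & g = (\prod_(s <- w) s)%g }.

(* A graph on V is given by its adjacency relation V -> V -> Prop. *)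

Definition graph_iso (V W : Type) (E : V -> V -> Prop) (F : W -> W -> Prop) :=
  exists2 f : V -> W, bijective f & forall x y, E x y <-> F (f x) (f y).

Definition cayley (G : markedGroup) (g h : G) : Prop :=
  exists2 s, s \in mg_gens G & h = (s * g)%g.

Definition full_shift (G : groupType) := prod_topology (fun _ : G => bool).

Definition shift_act (G : groupType) (g : G) (x : full_shift G) : full_shift G :=
  fun h => x (g^-1 * h)%g.

Definition free_part (G : groupType) : set (full_shift G) :=
  [set x | forall g : G, g != 1%g -> shift_act g x <> x].

(* The carrier carries the library's subspace topology on set_type. *)
Definition free_shift (G : groupType) := set_type (@free_part G).

HB.instance Definition _ (G : groupType) := Topological.on (free_shift G).

(* The library's measurable spaces are pointed; the free part always contains
   the indicator function of the identity. *)
Lemma free_part_delta (G : groupType) :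
  @free_part G (fun h : G => h == 1%g).
Proof.
move=> g /negP g1 /(congr1 (@^~ g)); rewrite /shift_act mulVg eqxx => /esym.
exact: g1.
Qed.

HB.instance Definition _ (G : groupType) := isPointed.Build (free_shift G)
  (SigSub (mem_set (@free_part_delta G))).

Definition shift_graph (G : markedGroup) (x y : free_shift G) : Prop :=
  x <> y /\ exists2 s, s \in mg_gens G & shift_act s (val x) = val y.

Definition coloring (V : Type) (E : V -> V -> Prop) (k : nat) (c : V -> 'I_k) :=
  forall x y, E x y -> c x <> c y.

Definition borel_set (X : topologicalType) : set (set X) := <<s @open X >>.

Definition nowhere_dense (X : topologicalType) (A : set X) :=
  interior (closure A) = set0.

Definition meager (X : topologicalType) (A : set X) :=
  exists2 F : nat -> set X, (forall n, nowhere_dense (F n)) &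
    A `<=` \bigcup_n F n.

Definition baire_property (X : topologicalType) : set (set X) :=
  [set A | exists2 U, open U & meager (A `+` U)].

Definition borelType (X : ptopologicalType) := g_sigma_algebraType (@open X).

(* The sets measurable for the completion of mu. *)
Definition mu_measurable (R : realType) (X : ptopologicalType)
    (mu : probability (borelType X) R) : set (set X) :=
  [set A | exists2 B, borel_set B & mu.-negligible (A `+` B)].

Section chromatic_numbers.
Variable R : realType.

(* Chromatic numbers live in \bar R so that suprema are available: the infimum
   of a nonempty set of naturals is its least element, and the infimum of the
   empty set (no finite coloring) is +oo. *)
Definition least (P : set nat) : \bar R := ereal_inf [set k%:R%:E | k in P]%R.

Definition chi (V : Type) (E : V -> V -> Prop) : \bar R :=
  least [set k | exists c : V -> 'I_k, coloring E c].

(* Least number of colors of a coloring whose color classes all belong to M. *)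
Definition chi_in (V : Type) (M : set (set V)) (E : V -> V -> Prop) : \bar R :=
  least [set k | exists2 c : V -> 'I_k, coloring E c &
                   forall i, M (c @^-1` [set i])].

Definition chi_B (X : topologicalType) (E : X -> X -> Prop) : \bar R :=
  chi_in (@borel_set X) E.

Definition chi_BM (X : topologicalType) (E : X -> X -> Prop) : \bar R :=
  chi_in (@baire_property X) E.

Definition chi_mu (X : ptopologicalType) (mu : probability (borelType X) R)
    (E : X -> X -> Prop) : \bar R :=
  chi_in (mu_measurable mu) E.

Definition chi_M (X : ptopologicalType) (E : X -> X -> Prop) : \bar R :=
  ereal_sup [set chi_mu mu E | mu in [set: probability (borelType X) R]].

End chromatic_numbers.

(* Main.v *)
(** Both groups are semidirect products of Z/k = <r> by Z = <t>, with t central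
    for Gamma and t inverting r for Delta, and with generators r^i (i <> 0) and
    (r^a t)^{+-1} (a <> 0, 1).  Every level {r^i t^n : i} of the common Cayley
    graph is a k-clique, and the missing edges between two consecutive levels
    form a single 2k-cycle, which has exactly two perfect matchings: in a
    k-coloring each level is obtained from the previous one by a rotation by 0
    or 1.  Modulo rotations, the coloring of a level is thus invariant under t
    in Gamma, and gets reflected by t in Delta.

    In Gamma, consecutive clopen markers can be joined by rotating the levels,
    and in Delta the same works with one additional color, which allows to
    recolor the vertices of a level one at a time.

    In Delta, a k-coloring would give a finite partition such that odd powers
    of t move every point to a different class.  If the coloring has the Baire
    property, some class is comeager in a nonempty open set V, and V meets its
    translate by a suitable odd power of t.  For the measure, we code an
    irrational rotation of the circle into the free part: some class has
    positive measure, hence by Steinhaus it meets its translates by all small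
    angles, in particular by the angle of an odd power of t. *)

Require Import Defs.
From HB Require Import structures.
From mathcomp Require Import all_boot all_order all_algebra.
From mathcomp Require Import all_classical all_reals all_analysis.
From mathcomp Require Import measurable_realfun.
From mathcomp Require Import zify ring lra.

Set Implicit Arguments.
Unset Strict Implicit.
Unset Printing Implicit Defensive.

Import Order.TTheory GRing.Theory Num.Theory.
Import numFieldNormedType.Exports.
Local Open Scope classical_set_scope.
Local Open Scope ring_scope.

(** * The free part of the shift *)

Section FreeShift.
Variable G : groupType.
Implicit Types (x y z : free_shift G) (g h : G) (S : seq G).

Lemma shift_actM g h (x : full_shift G) :
  shift_act (g * h)%g x = shift_act g (shift_act h x).
Proof. by apply/funext => u; rewrite /shift_act invgM mulgA. Qed.

Lemma shift_act1 (x : full_shift G) : shift_act 1%g x = x.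
Proof. by apply/funext => u; rewrite /shift_act invg1 mul1g. Qed.

Lemma free_part_act g (x : full_shift G) :
  free_part x -> free_part (shift_act g x).
Proof.
move=> fx h h1; rewrite -shift_actM => /(congr1 (shift_act g^-1%g)).
rewrite -!shift_actM mulVg shift_act1; apply: fx.
apply: contra h1 => /eqP /(congr1 (fun u => g * u * g^-1)%g).
by rewrite mulVKg mulg1 mulgV mulgK => /eqP.
Qed.

Lemma free_shiftP x : free_part (val x).
Proof. by case: x => x /= /set_mem. Qed.

Definition act g x : free_shift G :=
  SigSub (mem_set (@free_part_act g _ (@free_shiftP x))).

Lemma actE g x h : val (act g x) h = val x (g^-1 * h)%g.
Proof. by []. Qed.

Lemma actM g h x : act (g * h)%g x = act g (act h x).
Proof. by apply: val_inj; rewrite /= shift_actM. Qed.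

Lemma act1 x : act 1%g x = x.
Proof. by apply: val_inj; rewrite /= shift_act1. Qed.

Lemma actK g : cancel (act g) (act g^-1%g).
Proof. by move=> x; rewrite -actM mulVg act1. Qed.

Lemma actVK g : cancel (act g^-1%g) (act g).
Proof. by move=> x; rewrite -actM mulgV act1. Qed.

Lemma act_free g h x : act g x = act h x -> g = h.
Proof.
move=> /(congr1 (act h^-1%g)); rewrite actK -actM => hgx.
apply/eqP; rewrite eq_sym -(inj_eq (@mulgI _ h^-1%g)) mulVg eq_sym.
by apply: contraT => /(@free_shiftP x); case; exact: (congr1 val hgx).
Qed.

Definition agree S x y := forall h, h \in S -> val x h = val y h.

Lemma agree_cat S S' x y : agree (S ++ S') x y -> agree S x y /\ agree S' x y.
Proof. by move=> xy; split=> h hS; apply: xy; rewrite mem_cat hS ?orbT. Qed.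

Lemma agree_act S g x y : agree [seq g^-1 * h | h <- S]%g x y ->
  agree S (act g x) (act g y).
Proof. by move=> xy h hS; rewrite !actE; apply: xy; exact: map_f. Qed.

Lemma open_coord h (v : bool) : open [set x : free_shift G | val x h = v].
Proof.
have c : continuous (fun x => val x h).
  move=> x; apply: (@continuous_comp (free_shift G) (full_shift G) bool val (proj h)).
    exact: initial_continuous.
  exact: proj_continuous.
by move/continuousP: c => /(_ [set v]); apply; exact: discrete_open.
Qed.

Lemma open_agree S x : open [set y : free_shift G | agree S x y].
Proof.
elim: S => [|h S IH].
  suff -> : [set y : free_shift G | agree [::] x y] = setT by exact: openT.
  by apply/seteqP; split.
suff -> : [set y : free_shift G | agree (h :: S) x y] =
    [set y : free_shift G | agree S x y] `&` [set y | val y h = val x h].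
  by apply: openI => //; exact: open_coord.
apply/seteqP; split=> y /= => [xy|[xy xh] g].
  by split=> [g gS|]; rewrite xy ?inE ?eqxx ?gS ?orbT.
by rewrite inE => /orP[/eqP->//|/xy].
Qed.

Lemma openP (A : set (free_shift G)) :
  open A <-> forall x, A x -> exists S, forall y, agree S x y -> A y.
Proof.
split=> [[B oB <-] x Bx|H]; last first.
  rewrite openE => x /H[S SA]; apply: filterS (SA) _.
  by apply: open_nbhs_nbhs; split=> //; exact: open_agree.
(* [F] is generated by the cylinders around [x]. It converges to [x] in every coordinate, hence in
   the product topology, so the open set [B] contains one of them. *)
pose F : set_system (full_shift G) := [set D | exists S,
  forall y : full_shift G, (forall h, h \in S -> val x h = y h) -> D y].
have FF : Filter F.
  split=> [|D E [S HS] [S' HS']|D E DE [S HS]].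
  - by exists [::].
  - exists (S ++ S') => y xy; split; [apply: HS|apply: HS'] => h hS;
      by apply: xy; rewrite mem_cat hS ?orbT.
  - by exists S => y /HS/DE.
have : F --> (val x : full_shift G).
  apply/cvg_sup => h D; rewrite nbhsE => -[E [[W _ WE] Ex] ED].
  exists [:: h] => y xy; apply: ED; move: Ex; rewrite -WE /preimage /=.
  by rewrite xy ?mem_head.
move=> /(_ B) [|S HS]; first by apply: open_nbhs_nbhs.
by exists S => y xy; apply: HS.
Qed.

Lemma open_preimage_act g (A : set (free_shift G)) :
  open A -> open (act g @^-1` A).
Proof.
move=> /openP oA; apply/openP => x /oA[S SA].
by exists [seq g^-1 * h | h <- S]%g => y /agree_act/SA.
Qed.

Lemma open_forall_act S (A : set (free_shift G)) : open A ->
  open [set x | forall g, g \in S -> A (act g x)].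
Proof.
move=> oA; elim: S => [|h S IH].
  suff -> : [set x | forall g, g \in [::] -> A (act g x)] = setT by exact: openT.
  by apply/seteqP; split.
suff -> : [set x | forall g, g \in h :: S -> A (act g x)] = (act h @^-1` A) `&`
    [set x | forall g, g \in S -> A (act g x)].
  by apply: openI => //; exact: open_preimage_act.
apply/seteqP; split=> x /= => [H|[H1 H2] g]; last first.
  by rewrite inE => /orP[/eqP->|/H2].
by split=> [|g gS]; apply: H; rewrite inE ?eqxx ?gS ?orbT.
Qed.

End FreeShift.

Lemma shift_graphP (G : markedGroup) (x y : free_shift G) :
  shift_graph x y <-> exists2 s, s \in mg_gens G & act s x = y.
Proof.
split=> [[_ [s sS sxy]]|[s sS <-]]; first by exists s => //; exact: val_inj.
split; last by exists s.
rewrite -{1}(act1 x) => /act_free s1.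
by move: sS; rewrite -s1 (negbTE (mg_gens_neq1 G)).
Qed.

(** Equality would give [2 = 0] modulo [k]. This makes the twist a genuine reflection, and makes
    [-1] available as first coordinate of a generator of height one. *)
Lemma Zp_opp1_neq1 k : (2 < k)%N -> (-1 : 'Z_k) != 1.
Proof.
move=> k2; apply/eqP => /eqP; rewrite -subr_eq0 -opprD oppr_eq0 -(natrD _ 1 1).
move=> /eqP/(congr1 (@nat_of_ord _)).
by rewrite val_Zp_nat ?(ltnW k2)// modn_small.
Qed.

(** * The groups [Z/k x| Z] *)

(* The pair [(i, n)] stands for [r^i t^n]; the twist is [t r t^-1 = r^e] with
   [e = (-1) ^+ b], so [b = false] gives the direct product. *)
Definition twist_group (k : nat) (b : bool) : Type := ('Z_k * int)%type.

HB.instance Definition _ k b := Countable.on (twist_group k b).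

Section TwistGroup.
Variables (k : nat) (b : bool).
Local Notation G := (twist_group k b).
Implicit Types (i j : 'Z_k) (n m : int) (g h : G).

Definition twist n : 'Z_k := ((-1) ^+ b) ^ n.

Lemma twist_unit : ((-1) ^+ b : 'Z_k) \is a GRing.unit.
Proof. by rewrite unitrX// unitrN1. Qed.

Lemma twist0 : twist 0 = 1. Proof. by rewrite /twist expr0z. Qed.
Lemma twist1 : twist 1 = (-1) ^+ b. Proof. by rewrite /twist expr1z. Qed.

Lemma twistD n m : twist (n + m) = twist n * twist m.
Proof. by rewrite /twist exprzDr ?twist_unit. Qed.

Lemma twist_sign n : twist n = 1 \/ twist n = -1.
Proof.
by rewrite /twist; case: n => n; rewrite /exprz -exprM -signr_odd; case: (odd _);
  rewrite ?expr1 ?expr0 ?invr1 ?invrN1; auto.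
Qed.

Lemma twistK n : twist n * twist n = 1.
Proof. by case: (twist_sign n) => ->; rewrite ?mulrNN mulr1. Qed.

Lemma twistN n : twist (- n) = twist n.
Proof.
by rewrite -[RHS]mulr1 -(twistK (- n)) mulrA -twistD addrN twist0 mul1r.
Qed.

Lemma twist_mulK n : involutive ( *%R (twist n)).
Proof. by move=> i; rewrite mulrA twistK mul1r. Qed.

Lemma twist_mulI n : injective ( *%R (twist n)).
Proof. exact: inv_inj (@twist_mulK n). Qed.

Definition twist_mul g h : G := (g.1 + twist g.2 * h.1, g.2 + h.2).
Definition twist_inv g : G := (- (twist g.2 * g.1), - g.2).
Definition twist_one : G := (0, 0).

Lemma twist_mulA : associative twist_mul.
Proof.
move=> g h u; rewrite /twist_mul/= twistD; congr pair; last by rewrite addrA.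
by rewrite mulrDr mulrA addrA.
Qed.

Lemma twist_mul1g : left_id twist_one twist_mul.
Proof. by case=> i n; rewrite /twist_mul/= twist0 mul1r !add0r. Qed.

Lemma twist_mulg1 : right_id twist_one twist_mul.
Proof. by case=> i n; rewrite /twist_mul/= mulr0 !addr0. Qed.

Lemma twist_mulVg : left_inverse twist_one twist_inv twist_mul.
Proof. by case=> i n; rewrite /twist_mul/= twistN !addNr. Qed.

Lemma twist_mulgV : right_inverse twist_one twist_inv twist_mul.
Proof. by case=> i n; rewrite /twist_mul/= mulrN twist_mulK !addrN. Qed.

HB.instance Definition _ := isGroup.Build G
  twist_mulA twist_mul1g twist_mulg1 twist_mulVg twist_mulgV.

Lemma tmulE g h : (g * h)%g = (g.1 + twist g.2 * h.1, g.2 + h.2) :> G.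
Proof. by []. Qed.

Lemma tinvE g : (g^-1)%g = (- (twist g.2 * g.1), - g.2) :> G.
Proof. by []. Qed.

Lemma toneE : 1%g = (0, 0) :> G. Proof. by []. Qed.

Definition el i n : G := (i, n).

Lemma elM i j n m : (el i n * el j m)%g = el (i + twist n * j) (n + m).
Proof. by []. Qed.

Lemma elV i n : (el i n)^-1%g = el (- (twist n * i)) (- n).
Proof. by []. Qed.

(** The generators of height -1 enter [gens] as inverses. Excluding two values at height one leaves
    each vertex with exactly two non-neighbors on the next level. *)
Definition up_gen g : bool :=
  (g.2 == 0) && (g.1 != 0) || (g.2 == 1) && (g.1 != 0) && (g.1 != 1).

Definition gens : seq G :=
  [seq g <- [seq (i, n) : G | i <- enum 'Z_k, n <- [:: 0; 1; -1 : int]]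
     | up_gen g || up_gen g^-1%g].

Lemma mem_gens g : (g \in gens) = up_gen g || up_gen g^-1%g.
Proof.
rewrite mem_filter; case H : (up_gen g || up_gen g^-1%g) => //=.
case: g H => i n H; apply/flattenP; exists [:: (i, 0); (i, 1); (i, -1)]; first
  by apply: map_f; rewrite mem_enum.
rewrite !inE !xpair_eqE eqxx /=; move: H; rewrite /up_gen /=.
case/orP => /orP[/andP[+ _]|/andP[/andP[+ _] _]]; rewrite ?eqr_oppLR ?oppr0;
  by move=> ->; rewrite ?orbT.
Qed.

Lemma gens_sym g : g \in gens -> g^-1%g \in gens.
Proof. by rewrite !mem_gens invgK orbC. Qed.

Lemma gens_neq1 : 1%g \notin gens.
Proof. by rewrite mem_gens invg1 orbb /up_gen toneE /=. Qed.

Lemma mem_gens_rot i : i != 0 -> ((i, 0) : G) \in gens.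
Proof. by move=> i0; rewrite mem_gens /up_gen /= i0. Qed.

Lemma mem_gens_up i : i != 0 -> i != 1 -> ((i, 1) : G) \in gens.
Proof. by move=> i0 i1; rewrite mem_gens /up_gen /= i0 i1. Qed.

Lemma gens_generate (k2 : (2 < k)%N) g :
  exists2 w : seq G, {subset w <= gens} & g = (\prod_(s <- w) s)%g.
Proof.
pose gen g := exists2 w : seq G, {subset w <= gens} & g = (\prod_(s <- w) s)%g.
rewrite -/(gen g).
have gen1 : gen 1%g by exists [::]; rewrite ?big_nil.
have genM (g1 h : G) : gen g1 -> gen h -> gen (g1 * h)%g.
  move=> [w sw ->] [v sv ->]; exists (w ++ v); last by rewrite big_cat.
  by move=> x; rewrite mem_cat => /orP[/sw|/sv].
have genS h : h \in gens -> gen h.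
  by move=> hg; exists [:: h]; rewrite ?big_seq1// => x; rewrite inE => /eqP->.
have gen_r i : gen (i, 0).
  by have [->//|i0] := eqVneq i 0; apply/genS/mem_gens_rot.
(* [t] is not a generator, but [r^-1 t] is one since [-1] is neither 0 nor 1; then [t = r u]. *)
pose u : G := (-1, 1).
have gen_u : gen u /\ gen u^-1%g.
  suff H : u \in gens by split; apply: genS => //; exact: gens_sym.
  apply: mem_gens_up; first by rewrite oppr_eq0 oner_eq0.
  exact: Zp_opp1_neq1.
have gen_t : gen (0, 1).
  have -> : ((0, 1) : G) = (((1%R, 0%R) : G) * u)%g.
    by rewrite tmulE /= twist0 mul1r addrN add0r.
  by apply: genM => //; case: gen_u.
have gen_tV : gen (0, -1).
  have -> : ((0, -1) : G) = (u^-1 * ((-1)%R, 0%R))%g.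
    by rewrite tinvE tmulE /= twistN addr0 !mulrN1 opprK addrN.
  by apply: genM => //; case: gen_u.
have gen_tn n : gen (0, n).
  elim/int_ind: n => [//|n IH|n IH].
    have -> : ((0, n.+1%:Z) : G) = (((0%R, n%:Z) : G) * (0%R, 1%R))%g.
      by rewrite tmulE /= mulr0 addr0; congr pair; lia.
    exact: genM.
  have -> : ((0, - n.+1%:Z) : G) = (((0%R, (- n%:Z)%R) : G) * (0%R, (-1)%R))%g.
    by rewrite tmulE /= mulr0 addr0; congr pair; lia.
  exact: genM.
case: g => i n; have -> : ((i, n) : G) = (((i, 0%R) : G) * (0%R, n))%g.
  by rewrite tmulE /= mulr0 addr0 add0r.
exact: genM.
Qed.

End TwistGroup.

Definition twist_marked k b (k2 : (2 < k)%N) : markedGroup :=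
  MarkedGroup (@gens_sym k b) (@gens_neq1 k b) (@gens_generate k b k2).

Lemma cayley_twistP k b (k2 : (2 < k)%N) (g h : twist_marked b k2) :
  @cayley (twist_marked b k2) g h <-> up_gen (h * g^-1)%g || up_gen (g * h^-1)%g.
Proof.
have -> : (g * h^-1 = (h * g^-1)^-1)%g by rewrite invgM invgK.
rewrite -(mem_gens (h * g^-1)%g : _ = _); split=> [[s sg ->]|hg].
  by rewrite mulgK.
by exists (h * g^-1)%g => //; rewrite mulgVK.
Qed.

(** * The isomorphism between the two Cayley graphs *)

Section CayleyIso.
Variables (k : nat) (k2 : (2 < k)%N).
Local Notation Gam := (twist_marked false k2).
Local Notation Del := (twist_marked true k2).

(* Untwisting the levels of [Del] reflects every other level; the reflection
   maps the excluded pair {0, 1} to {0, -1}, hence the drift by one at every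
   second level. *)
Definition drift (n : int) : 'Z_k := ((n + 1) %/ 2)%Z%:~R.

Definition untwist (g : twist_group k true) : twist_group k false :=
  (twist k true g.2 * g.1 + drift g.2, g.2).

(** For [k > 2] the test [twist k true n == 1] detects even [n], and the floor of [(n + 1) / 2]
    grows exactly when leaving an even level. *)
Lemma drift_step n : drift (n + 1) =
  drift n + (if twist k true n == 1 then 1 else 0).
Proof.
rewrite /drift; have [m [->|->]] : exists m : int, n = 2 * m \/ n = 2 * m + 1.
- by exists (n %/ 2)%Z; lia.
- have -> : twist k true (2 * m) = 1.
    by rewrite -(mul1r m) mulrA mulr1 mulrDl mul1r twistD twistK.
  rewrite eqxx; have -> : ((2 * m + 1 + 1) %/ 2)%Z = m + 1 by lia.
  have -> : ((2 * m + 1) %/ 2)%Z = m by lia.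
  by rewrite intrD.
have -> : twist k true (2 * m + 1) = -1.
  by rewrite -(mul1r m) mulrA mulr1 mulrDl mul1r !twistD twistK mul1r twist1.
have -> : ((2 * m + 1 + 1 + 1) %/ 2)%Z = m + 1 by lia.
have -> : ((2 * m + 1 + 1) %/ 2)%Z = m + 1 by lia.
rewrite ifN ?addr0//.
exact: Zp_opp1_neq1.
Qed.

(** For vertices [(i, n)] and [(j, n + 1)] the quotient in [Del] has first coordinate [j + i]. After
    untwisting it is [1 - (j + i)] for even [n] and [j + i] for odd [n], and [x -> 1 - x] preserves
    the excluded pair {0, 1}. *)
Lemma untwist_up (g h : twist_group k true) :
  up_gen (untwist h / untwist g)%g = up_gen (h / g)%g.
Proof.
case: g h => i n [j m].
rewrite /up_gen !(tmulE, tinvE) /untwist /=.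
have tF x : twist k false x = 1 by rewrite /twist expr0 exp1rz.
rewrite !tF !mul1r !mulrN !mulrA -!twistD.
have [/eqP|mn0] /= := eqVneq (m - n) 0.
  rewrite subr_eq0 => /eqP->; rewrite twistD twistK mul1r.
  rewrite subrr /= !orbF; congr (~~ _).
  have -> : twist k true n * j + drift n - (twist k true n * i + drift n) =
    twist k true n * (j - i) by ring.
  by rewrite -{1}(mulr0 (twist k true n)) (inj_eq (@twist_mulI k true n)).
have [/eqP|//] := eqVneq (m - n) 1; rewrite subr_eq addrC => /eqP-> /=.
rewrite (addrAC n 1 n) !twistD twistK mul1r twist1 expr1 drift_step.
have [->|->] := twist_sign k true n.
  rewrite eqxx.
  have -> : 1 * -1 * j + (drift n + 1) - (1 * i + drift n) = 1 - (j + i) by ring.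
  rewrite subr_eq0 eq_sym andbC mulN1r opprK; congr (~~ _ && ~~ _).
  by rewrite -[X in _ == X]subr0 (inj_eq (addrI _)) eqr_opp.
rewrite (negbTE (Zp_opp1_neq1 k2)).
by have -> : -1 * -1 * j + (drift n + 0) - (- 1 * i + drift n) = j - (-1) * i by ring.
Qed.

Lemma untwist_bij : bijective untwist.
Proof.
exists (fun g => (twist k true g.2 * (g.1 - drift g.2), g.2)) => -[i n] /=.
  by rewrite /untwist /= addrK twist_mulK.
by rewrite /untwist /= twist_mulK subrK.
Qed.

Lemma cayley_iso : graph_iso (@cayley Gam) (@cayley Del).
Proof.
have [f unK fK] := untwist_bij.
exists f; first by exists untwist.
move=> x y; rewrite !cayley_twistP -(untwist_up (f x) (f y)).
by rewrite -(untwist_up (f y) (f x)) !fK.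
Qed.

End CayleyIso.

(** * Clopen marker sets *)

Section Markers.
Variables (G : groupType) (pkl : seq (G * bool) -> nat)
  (upkl : nat -> option (seq (G * bool))) (pklK : pcancel pkl upkl).
Variable B : seq G.
Hypotheses (B1 : 1%g \in B) (BV : forall b, b \in B -> b^-1%g \in B).
Implicit Types (x y z : free_shift G) (p : seq (G * bool)).

Let cyl p : set (free_shift G) := [set x | forall hv, hv \in p -> val x hv.1 = hv.2].

Let good p := forall b, b \in B -> b != 1%g -> forall x, cyl p x -> ~ cyl p (act b x).

(** By freeness, every nontrivial [b] in [B] has a coordinate at which [x] and [act b x] differ.
    Prescribing both of these values for each [b] separates the cylinder from its translates. *)
Let good_nbhs x : exists p, cyl p x /\ good p.
Proof.
suff [p px pB] : exists2 p, cyl p x & forall b, b \in B -> b != 1%g ->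
    exists2 h, (h, val x h) \in p & (b^-1 * h, ~~ val x h)%g \in p.
  exists p; split=> // b bB b1 y py pby; have [h h1 h2] := pB b bB b1.
  have := pby _ h1; rewrite /= /shift_act (py _ h2) /=; by case: (val x h).
have H (b : G) : b != 1%g -> exists h, val x (b^-1 * h)%g = ~~ val x h.
  move=> b1; apply: contrapT => nh; apply: (@free_shiftP _ x _ b1).
  apply/funext => h; rewrite /shift_act; apply/eqP; apply: contraT => /negP hn.
  by exfalso; apply: nh; exists h; case: (val x h) hn; case: (val x _) => // /(_ isT).
have {}H (b : G) : exists h, b != 1%g -> val x (b^-1 * h)%g = ~~ val x h.
  have [->|/H[h xh]] := eqVneq b 1%g; first by exists 1%g.
  by exists h.
have [f Hf] := choice H.
exists (flatten [seq [:: (f b, val x (f b)); (b^-1 * f b, val x (b^-1 * f b))]%g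
  | b <- B]).
  move=> hv /flattenP[s /mapP[b bB ->]]; rewrite !inE.
  by case/orP => /eqP ->.
move=> b bB b1; exists (f b); apply/flattenP; eexists.
- by apply/mapP; exists b.
- by rewrite inE eqxx.
- by apply/mapP; exists b.
by rewrite -Hf// !inE eqxx orbT.
Qed.

Let W n : set (free_shift G) :=
  [set x | if upkl n is Some p then good p /\ cyl p x else False].

(** A greedy maximal [B]-independent set: stage [n] adds the points of the [n]-th cylinder, if it is
    good, that have no neighbor chosen before. Goodness prevents conflicts between points added at
    the same stage. *)
Let T := fix T n : set (free_shift G) := if n is n'.+1 then
  T n' `|` [set x | W n' x /\ forall b, b \in B -> ~ T n' (act b x)] else set0.

Let T_homo m n x : (m <= n)%N -> T m x -> T n x.
Proof. by move=> /subnK <-; elim: (n - m)%N => // d IH /IH; left. Qed.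

Let T_discrete n x b : b \in B -> b != 1%g -> T n x -> ~ T n (act b x).
Proof.
elim: n x b => [//|n IH] x b bB b1 /= [Tx|[Wx nTx]] [Tbx|[Wbx nTbx]].
- exact: IH Tx Tbx.
- by apply: (nTbx _ (BV bB)); rewrite actK.
- exact: nTx Tbx.
- by move: Wx Wbx; rewrite /W /=; case: (upkl n) => // p [gp px] [_]; exact: gp px.
Qed.

Let T_clopen n : open (T n) /\ open (~` T n).
Proof.
elim: n => [|n [IHo IHc]] /=; first by rewrite setC0; split; [exact: open0|exact: openT].
have Wo : open (W n) /\ open (~` W n).
  rewrite /W; case: (upkl n) => [p|]; last first.
    rewrite (_ : mkset (fun=> False) = set0)//.
    by rewrite setC0; split; [exact: open0|exact: openT].
  have ag x y : agree (unzip1 p) x y -> cyl p x -> cyl p y.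
    by move=> xy px hv hvp; rewrite -xy ?px//; exact: map_f.
  split; apply/openP => x.
    by move=> [gp px]; exists (unzip1 p) => y /ag xy; split=> //; exact: xy.
  move=> px; exists (unzip1 p) => y xy [gp py]; apply: px; split=> //.
  by apply: ag py => h hp; rewrite xy.
have [Woo Woc] := Wo.
split.
  by apply: openU => //; apply: openI => //; exact: (open_forall_act B IHc).
rewrite setCU; apply: openI => //.
suff -> : ~` [set x | W n x /\ forall b, b \in B -> ~ T n (act b x)] =
    ~` W n `|` \bigcup_(b in [set` B]) (act b @^-1` T n).
  by apply: openU => //; apply: bigcup_open => b _; exact: open_preimage_act.
apply/seteqP; split=> x /=.
  move=> /not_andP[|/existsNP[b /not_implyP[bB /contrapT Tb]]]; first by left.
  by right; exists b.
by move=> [nW [//]|[b bB Tb] [_ /(_ _ bB)]].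
Qed.

Lemma marker_set : exists M : set (free_shift G),
  [/\ open M, open (~` M),
      forall x b, b \in B -> b != 1%g -> M x -> ~ M (act b x) &
      forall x, exists2 b, b \in B & M (act b x)].
Proof.
pose M : set (free_shift G) := \bigcup_n T n.
have dis x b : b \in B -> b != 1%g -> M x -> ~ M (act b x).
  move=> bB b1 [m _ Tx] [n _ Tbx].
  have := T_homo (leq_maxl m n) Tx; have := T_homo (leq_maxr m n) Tbx.
  by move=> /[swap]; exact: T_discrete.
have cov x : exists2 b, b \in B & M (act b x).
  have [p [px gp]] := good_nbhs x.
  have Wx : W (pkl p) x by rewrite /W /= pklK.
  have [[b bB Tb]|nb] := pselect (exists2 b, b \in B & T (pkl p) (act b x)).
    by exists b => //; exists (pkl p).
  exists 1%g => //; exists (pkl p).+1 => //; rewrite act1; right; split=> // b bB Tb.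
  by apply: nb; exists b.
exists M; split=> //.
  by apply: bigcup_open => n _; case: (T_clopen n).
(* As an infinite union of clopen sets, [M] is only known to be open. By maximality and independence
   its complement is a union of translates of [M], hence open too. *)
suff -> : ~` M = \bigcup_(b in [set b : G | b \in B /\ b != 1%g]) (act b @^-1` M).
  apply: bigcup_open => b _; apply: open_preimage_act.
  by apply: bigcup_open => n _; case: (T_clopen n).
apply/seteqP; split=> x /=.
  move=> nM; have [b bB Mb] := cov x; exists b => //; split=> //.
  by apply: contra_notN nM => /eqP b1; rewrite b1 act1 in Mb.
by move=> [b [bB b1] Mb] Mx; exact: dis Mx Mb.
Qed.

End Markers.

(** * Gluing colored strips *)

Section Glue.
Variables (k : nat) (b : bool) (K L : nat) (io : 'Z_k -> 'I_K).
Local Notation G := (twist_group k b).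
Local Notation tw := (twist k b).
Local Notation el := (@el k b).

(** A strip will join two consecutive markers [N] levels apart. Both ends carry the same coloring
    [io], each read from its own marker; [j] is the offset between the two readings. *)
Hypothesis strip : forall (N : nat) (j : 'Z_k), (L < N)%N ->
  exists P : nat -> 'Z_k -> 'I_K,
  [/\ forall l, P 0 l = io l, forall l, P N l = io (l + j),
      forall n, (n <= N)%N -> injective (P n) &
      forall n (a l : 'Z_k), (n < N)%N -> a != 0 -> a != 1 ->
        P n.+1 (a + tw 1 * l) <> P n l].

(** All rotations are included, so [B]-independence keeps the markers of one orbit more than [L]
    levels apart, with at most one on each level. *)
Let B : seq G := [seq el i n | i <- enum 'Z_k,
  n <- [seq m%:Z - L%:Z | m <- seq.iota 0 (L + L).+1]].

Let mem_B i n : (el i n \in B) = (`|n| <= L)%N.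
Proof.
apply/allpairsP/idP => [[[i' n'] [_ n'B [_ ->]]]|nL].
  have /mapP[m mL /= ->] : n' \in [seq m%:Z - L%:Z | m <- seq.iota 0 (L + L).+1] by [].
  by move: mL; rewrite mem_iota; lia.
exists (i, n); split=> //; first by rewrite mem_enum.
change (n \in [seq m%:Z - L%:Z | m <- seq.iota 0 (L + L).+1]).
by apply/mapP; exists (absz (n + L%:Z)); rewrite ?mem_iota; lia.
Qed.

Let markers : exists M : set (free_shift G),
  [/\ open M, open (~` M),
      forall x i n, (`|n| <= L)%N -> M x -> M (act (el i n) x) -> i = 0 /\ n = 0 &
      forall x, exists i n, (`|n| <= L)%N /\ M (act (el i n) x)].
Proof.
have B1 : 1%g \in B by rewrite -[1%g]/(el 0 0) mem_B.
have BV g : g \in B -> g^-1%g \in B.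
  by case: g => i n; rewrite -[(i, n)]/(el i n) tinvE -[(_, _)]/(el _ _) !mem_B /=; lia.
have [M [oM cM dM tM]] := marker_set (@pickleK (seq (G * bool))) B1 BV.
exists M; split=> //.
  move=> x i n nL Mx Min; apply: contrapT => ne; apply: (dM x (el i n)) => //.
    by rewrite mem_B.
  by apply/eqP => -[i0 n0]; apply: ne.
move=> x; have [[i n]] := tM x; rewrite -[(i, n)]/(el i n) mem_B => nL MB.
by exists i, n.
Qed.

Lemma glue_strips : exists c : free_shift G -> 'I_K,
  [/\ forall v, open (c @^-1` [set v]),
      forall x (i : 'Z_k), i != 0 -> c (act (el i 0) x) <> c x &
      forall x (a : 'Z_k), a != 0 -> a != 1 -> c (act (el a 1) x) <> c x].
Proof.
have [M [oM cM dM tM]] := markers.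
have prevE x : exists (n : nat) i, M (act (el i (- n%:Z)) x) /\
    forall n', (n' < n)%N -> forall i', ~ M (act (el i' (- n'%:Z)) x).
  pose Q n := `[< exists i, M (act (el i (- n%:Z)) x) >].
  have exQ : exists n, Q n.
    (* A marker within [L] levels of a point [L] levels below [x] is not above [x]. In [nextE],
       starting [L + 1] levels above makes the height positive. *)
    have [i [n [nL MB]]] := tM (act (el 0 (- L%:Z)) x).
    exists (absz (L%:Z - n)); apply/asboolP; exists i.
    move: MB; rewrite -actM elM mulr0 addr0.
    by have -> : n - L%:Z = - (absz (L%:Z - n))%:Z by lia.
  have [n /asboolP[i Mi] minn] := ex_minnP exQ.
  exists n, i; split=> // n' n'n i' Mi'.
  by have := minn n'; rewrite leqNgt n'n => H; apply: notF; apply: H; apply/asboolP; exists i'.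
have nextE m : M m -> exists (N : nat) (j : 'Z_k), [/\ (L < N)%N, M (act (el (- j) N) m) &
    forall n', (0 < n' < N)%N -> forall i', ~ M (act (el i' n') m)].
  move=> Mm; pose Q n := (0 < n)%N && `[< exists i, M (act (el i n%:Z) m) >].
  have exQ : exists n, Q n.
    have [i [n [nL MB]]] := tM (act (el 0 (L.+1%:Z)) m).
    exists (absz (n + L.+1%:Z)); apply/andP; split; first by lia.
    apply/asboolP; exists i.
    move: MB; rewrite -actM elM mulr0 addr0.
    by have -> : n + L.+1%:Z = (absz (n + L.+1%:Z))%:Z by lia.
  have [N /andP[N0 /asboolP[i Mi]] minN] := ex_minnP exQ.
  exists N, (- i); split; rewrite ?opprK//.
    rewrite ltnNge; apply/negP => NL.
    by have [_ NZ] := dM m i N NL Mm Mi; lia.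
  move=> n' /andP[n'0 n'N] i' Mi'.
  have := minN n'; rewrite leqNgt n'N => H; apply: notF; apply: H.
  by rewrite /Q n'0; apply/asboolP; exists i'.
(* Coordinates of [x]: it is [el l n] applied to [m], the last marker not above it, and the next
   marker is [N] levels above [m]. On the level of that next marker, position [l] seen from [m] is
   position [l + j] seen from the new marker. *)
pose D x (n : nat) (l : 'Z_k) (N : nat) (j : 'Z_k) := let m := act (el l n%:Z)^-1%g x in
  [/\ M m, (n < N)%N, (L < N)%N, M (act (el (- j) N%:Z) m) &
      forall n', (0 < n' < N)%N -> forall i', ~ M (act (el i' n'%:Z) m)].
have D_ex x : exists n l N j, D x n l N j.
  have [n [i [Mi minn]]] := prevE x.
  have eqm : (el i (- n%:Z) = (el (- (tw n * i)) n)^-1)%g.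
    by rewrite elV mulrN twist_mulK opprK.
  have [N [j [LN MN minN]]] := nextE _ Mi.
  exists n, (- (tw n * i)), N, j; rewrite /D -eqm; split=> //.
  rewrite ltnNge; apply/negP => Nn; apply: (minn (n - N)%N); first by lia.
  move: MN; rewrite -actM elM.
  have -> : N%:Z + - n%:Z = - (n - N)%N%:Z by lia.
  exact.
have D_uniq x n l N j n1 l1 N1 j1 : D x n l N j -> D x n1 l1 N1 j1 ->
    [/\ n = n1, l = l1, N = N1 & j = j1].
  have key n2 l2 N2 j2 n3 l3 N3 j3 : D x n2 l2 N2 j2 -> D x n3 l3 N3 j3 ->
      (n3 <= n2)%N.
    move=> [M2 nN2 LN2 MN2 min2] [M3 nN3 LN3 MN3 min3].
    rewrite leqNgt; apply/negP => n23.
    have : M (act ((el l2 n2)^-1 * el l3 n3)%g (act (el l3 n3)^-1%g x)).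
      by rewrite actM actVK.
    rewrite elV elM.
    have -> : - n2%:Z + n3 = (n3 - n2)%N by lia.
    by apply: min3; lia.
  have keyN n2 l2 N2 j2 N3 j3 : D x n2 l2 N2 j2 -> D x n2 l2 N3 j3 -> (N3 <= N2)%N.
    move=> [M2 nN2 LN2 MN2 min2] [M3 nN3 LN3 MN3 min3].
    by rewrite leqNgt; apply/negP => n23; apply: (min3 N2 _ _ MN2); lia.
  move=> D1 D2.
  have nn : n = n1 by apply/eqP; rewrite eqn_leq (key _ _ _ _ _ _ _ _ D1 D2) (key _ _ _ _ _ _ _ _ D2 D1).
  rewrite -{n1}nn in D2 *.
  have ll : l = l1.
    have [M1 _ _ _ _] := D1; have [M2 _ _ _ _] := D2.
    have : M (act ((el l1 n)^-1 * el l n)%g (act (el l n)^-1%g x)).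
      by rewrite actM actVK.
    rewrite elV elM addNr => /(dM _ _ _ _ M1)[//|/eqP + _].
    by rewrite addrC twistN subr_eq0 => /eqP/twist_mulI.
  rewrite -{l1}ll in D2 *.
  have NN : N = N1 by apply/eqP; rewrite eqn_leq (keyN _ _ _ _ _ _ D1 D2) (keyN _ _ _ _ _ _ D2 D1).
  rewrite -{N1}NN in D2 *.
  split=> //.
  have [_ _ _ M1 _] := D1; have [_ _ _ M2 _] := D2.
  move: M2; set m := act _^-1%g x => M2.
  have : M (act ((el (- j1) N) * (el (- j) N)^-1)%g (act (el (- j) N) m)).
    by rewrite actM actK.
  rewrite elV elM addrN mulrN twist_mulK => /(dM _ _ _ _ M1)[//|/eqP + _].
  by rewrite opprK addrC subr_eq0 => /eqP.
(* Only finitely many translates of [x] are tested against the clopen set [M]. *)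
have D_open n l N j : open [set x | D x n l N j].
  have [nN|nN] := boolP ((n < N)%N && (L < N)%N); last first.
    rewrite (_ : mkset _ = set0); first exact: open0.
    by apply/seteqP; split=> // x [_ h1 h2 _ _]; rewrite h1 h2 in nN.
  pose s := [seq el i n'%:Z | i <- enum 'Z_k, n' <- seq.iota 1 N.-1].
  suff -> : [set x | D x n l N j] = act (el l n%:Z)^-1%g @^-1`
      (M `&` (act (el (- j) N%:Z) @^-1` M) `&`
       [set x | forall g, g \in s -> (~` M) (act g x)]).
    apply: open_preimage_act; apply: openI; last exact: open_forall_act.
    by apply: openI => //; exact: open_preimage_act.
  case/andP: nN => nN LN.
  apply/seteqP; split=> x /=.
    move=> [M1 _ _ M2 min]; split=> // g /allpairsP[[i n'] /= [_ + ->]].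
    by rewrite mem_iota => n'N; apply: min; lia.
  move=> [[M1 M2] min]; split=> // n' n'N i'; apply: min.
  by apply: allpairs_f; rewrite ?mem_enum// mem_iota; lia.
(* Moving the bound on [N] under the existential allows a choice for all pairs; the default value is
   never read, since [D] forces [L < N]. *)
have strip' N j : exists P : nat -> 'Z_k -> 'I_K, (L < N)%N ->
  [/\ forall l, P 0%N l = io l, forall l, P N l = io (l + j),
      forall n, (n <= N)%N -> injective (P n) &
      forall n (a l : 'Z_k), (n < N)%N -> a != 0 -> a != 1 ->
        P n.+1 (a + tw 1 * l) <> P n l].
  have [LN|LN] := boolP (L < N)%N; first by have [P HP] := strip j LN; exists P.
  by exists (fun=> io).
have [P HP] := choice (fun Nj : nat * 'Z_k => strip' Nj.1 Nj.2).
have D_ex' x : exists d : nat * 'Z_k * nat * 'Z_k, D x d.1.1.1 d.1.1.2 d.1.2 d.2.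
  by have [n [l [N [j Dx]]]] := D_ex x; exists (n, l, N, j).
have [d Hd] := choice D_ex'.
pose c x := P ((d x).1.2, (d x).2) (d x).1.1.1 (d x).1.1.2.
have cE x n l N j : D x n l N j -> c x = P (N, j) n l.
  by move=> Dx; rewrite /c; have [-> -> -> ->] := D_uniq _ _ _ _ _ _ _ _ _ (Hd x) Dx.
exists c; split.
- move=> v; rewrite openE => x cx; rewrite /interior nbhsE.
  exists [set y | D y (d x).1.1.1 (d x).1.1.2 (d x).1.2 (d x).2].
    by split; [exact: D_open|exact: Hd].
  by move=> y /= /cE ->; exact: cx.
- move=> x i i0; have [n [l [N [j Dx]]]] := D_ex x.
  have [M1 nN LN M2 min] := Dx.
  have eqm : act (el (i + l) n)^-1%g (act (el i 0) x) = act (el l n)^-1%g x.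
    by rewrite -actM -[el i 0]invgK -invgM elV elM !(twist0, oppr0, mul1r, add0r, addKr).
  have Dy : D (act (el i 0) x) n (i + l) N j by rewrite /D eqm.
  rewrite (cE _ _ _ _ _ Dx) (cE _ _ _ _ _ Dy).
  have [_ _ inj _] := HP (N, j) LN.
  move/(inj _ (ltnW nN))/eqP; rewrite -subr_eq0 addrK => /eqP.
  by move: i0 => /eqP.
- move=> x a a0 a1; have [n [l [N [j Dx]]]] := D_ex x.
  have [M1 nN LN M2 min] := Dx.
  set y := act _ x; set m := act (el l n)^-1%g x in M1 M2 min.
  have ym : y = act (el (a + tw 1 * l) n.+1) m.
    have -> : el (a + tw 1 * l) n.+1 = (el a 1%:Z * el l n%:Z)%g.
      by rewrite elM; congr pair; lia.
    by rewrite /m actM actVK.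
  have [P0 PN inj step] := HP (N, j) LN.
  rewrite (cE _ _ _ _ _ Dx).
  have [nN'|] := ltnP n.+1 N.
    have Dy : D y n.+1 (a + tw 1 * l) N j by rewrite /D ym actK.
    by rewrite (cE _ _ _ _ _ Dy); exact: step.
  (* Now [y] is on the level of the next marker, so its color comes from the bottom of the next
     strip, which agrees with the top of the current one. *)
  move=> Nn; have eN : N = n.+1 by lia.
  subst N.
  have [N' [j' [LN' M' min']]] := nextE _ M2.
  have Dy : D y 0%N (a + tw 1 * l + j) N' j'.
    rewrite /D; have -> : act (el (a + tw 1 * l + j) 0)^-1%g y = act (el (- j) n.+1) m.
      rewrite ym -actM elV elM oppr0 twist0 !mul1r add0r; congr (act (el _ _) _).
      by ring.
    by split=> //; lia.
  rewrite (cE _ _ _ _ _ Dy); have [P0' _ _ _] := HP (N', j') LN'.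
  by rewrite P0' -PN; exact: step.
Qed.

End Glue.

(** * Colorings of strips *)

(* A level carries an injective coloring; from one level to the next only one
   vertex changes, and it receives a color absent from the previous level. *)
Section Recoloring.
Variables (T C : finType).
Implicit Types f g h : T -> C.

Definition level_step f g := injective g /\ forall i i', i != i' -> g i' <> f i.

Fixpoint level_path n f g :=
  if n is n'.+1 then exists2 h, level_path n' f h & level_step h g else f = g.

Lemma level_path_inj n f g : injective f -> level_path n f g -> injective g.
Proof. by move=> fi; case: n => [<-//|n [h _ []]]. Qed.

Lemma level_step_refl f : injective f -> level_step f f.
Proof. by move=> fi; split=> // i i' ii' /fi/eqP; rewrite eq_sym (negbTE ii'). Qed.

Lemma level_path_pad n d f g :
  injective f -> level_path n f g -> level_path (d + n) f g.
Proof.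
move=> fi fg; elim: d => // d IH /=; exists g => //.
exact/level_step_refl/(level_path_inj fi fg).
Qed.

Lemma level_path_fun n f g : injective f -> level_path n f g ->
  exists q : nat -> T -> C, [/\ q 0%N = f, q n = g,
    forall m, (m <= n)%N -> injective (q m) &
    forall m, (m < n)%N -> level_step (q m) (q m.+1)].
Proof.
move=> fi; elim: n g => [g <-|n IH g [h /IH[q [q0 qn qi qs]] hg]].
  by exists (fun=> f).
exists (fun m => if (m <= n)%N then q m else g); split=> //=.
- by rewrite ltnn.
- by move=> m _; case: leqP => [/qi//|_]; case: hg.
move=> m; rewrite ltnS => mn; rewrite mn; case: ltnP => [/qs//|nm].
have -> : m = n by lia.
by rewrite qn.
Qed.

Lemma level_path_cat m n f g h :
  level_path m f g -> level_path n g h -> level_path (n + m) f h.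
Proof.
by move=> fg; elim: n h => [h <-//|n IH h [h' /IH p s]]; exists h'.
Qed.

Lemma level_step_set f i c : injective f -> (forall j, f j <> c) ->
  level_step f (fun j => if j == i then c else f j).
Proof.
move=> fi fc; split=> [j l|j l jl].
  have [->|] := eqVneq j i; have [->|] := eqVneq l i => //.
  - by move=> _ /esym /fc.
  - by move=> _ /fc.
  - by move=> _ _ /fi.
case: ifP => _; first by move=> /esym /fc.
by move=> /fi/eqP; rewrite eq_sym (negbTE jl).
Qed.

Hypothesis TC : (#|T| < #|C|)%N.

Lemma missing_color f : injective f -> exists c, forall i, f i <> c.
Proof.
move=> fi; apply: contrapT => nc.
have : (#|C| <= #|codom f|)%N.
  apply: subset_leq_card; apply/fintype.subsetP => c _; apply: contraT => /codomP nf.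
  by exfalso; apply: nc; exists c => i fic; apply: nf; exists i.
by rewrite card_codom// leqNgt TC.
Qed.

(** If another vertex [l] holds the color [g i], first move [l] to a missing color, then give [g i]
    to [i]. As [g] is injective, [l] did not yet agree with [g], so nothing already settled is
    disturbed. Idle steps make the length always 2. *)
Lemma level_path_fix f g i : injective f -> injective g ->
  exists2 h, level_path 2 f h & forall j, j = i \/ f j = g j -> h j = g j.
Proof.
move=> fi gi; have [[l li fl]|nl] := pselect (exists2 l, l != i & f l = g i); last first.
  have [fgi|fgi] := eqVneq (f i) (g i).
    exists f; last by move=> j [->|].
    by exists f; [exists f => //|]; exact: level_step_refl.
  have nf j : f j <> g i.
    move=> fj; have [ji|ji] := eqVneq j i; last by apply: nl; exists j.
    by rewrite -ji fj ji eqxx in fgi.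
  exists (fun j => if j == i then g i else f j).
    exists f; last exact: level_step_set.
    by exists f => //; exact: level_step_refl.
  by move=> j; have [->//|ji [jj|//]] := eqVneq j i; rewrite jj eqxx in ji.
have [c fc] := missing_color fi.
pose f1 j := if j == l then c else f j.
have s1 : level_step f f1 by exact: level_step_set.
have nf1 j : f1 j <> g i.
  rewrite /f1; have [_ ci|jl fj] := eqVneq j l; first by apply: (fc l); rewrite fl ci.
  by move: jl; rewrite (fi j l) ?eqxx// fj fl.
exists (fun j => if j == i then g i else f1 j).
  by exists f1; [exists f|apply: level_step_set => //; case: s1].
move=> j; have [->//|ji [jj|fj]] := eqVneq j i; first by rewrite jj eqxx in ji.
rewrite /f1 ifN//; apply: contraNneq ji => jl; apply/eqP/gi.
by rewrite -fj jl fl.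
Qed.

(** The vertices are settled one after another, two steps each. *)
Lemma level_path_total f g : injective f -> injective g ->
  level_path (2 * #|T|) f g.
Proof.
move=> fi gi.
suff [h fh hg] : exists2 h, level_path (2 * size (enum T)) f h &
    forall j, j \in enum T -> h j = g j.
  rewrite cardE; suff -> : g = h by [].
  by apply/funext => j; rewrite hg ?mem_enum.
elim: (enum T) => [|i s [h fh hg]]; first by exists f.
have [h' hh' h'g] := level_path_fix i (level_path_inj fi fh) gi.
exists h'; first by rewrite mulnS; exact: level_path_cat hh'.
by move=> j; rewrite inE => /orP[/eqP ->|/hg hj]; apply: h'g; [left|right].
Qed.

End Recoloring.

(** * Strips for the direct and for the twisted product *)

Section Strips.
Variable k' : nat.
Let k := k'.+3.

(** The coloring rotates by one at each of the first [d] levels, where [d < k] represents [-j], and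
    then stays constant. A rotating step conflicts only along [a = 1] and a constant one only along
    [a = 0], both excluded. *)
Lemma strip_direct (N : nat) (j : 'Z_k) : (k < N)%N ->
  exists P : nat -> 'Z_k -> 'I_k,
  [/\ forall l, P 0%N l = l, forall l, P N l = l + j,
      forall n, (n <= N)%N -> injective (P n) &
      forall n (a l : 'Z_k), (n < N)%N -> a != 0 -> a != 1 ->
        P n.+1 (a + twist k false 1 * l) <> P n l].
Proof.
move=> kN; pose d := nat_of_ord (- j).
have dk : (d < k)%N by exact: ltn_ord.
exists (fun n l => l - (minn n d)%:R : 'Z_k); split.
- by move=> l; rewrite min0n subr0.
- move=> l; rewrite (minn_idPr _); last by lia.
  by rewrite /d natr_Zp opprK.
- by move=> n _; exact: addIr.
move=> n a l _ a0 a1; rewrite twist1 expr0 mul1r => /eqP.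
have [nd|dn] := ltnP n d.
  rewrite (minn_idPl nd) -natr1 opprD.
  have -> : a + l + (- n%:R - 1) = l - n%:R + (a - 1) by ring.
  by rewrite -[eqbRHS]addr0 (inj_eq (addrI _)) subr_eq0 (negbTE a1).
rewrite (minn_idPr _); last by lia.
by rewrite -addrA -[eqbRHS]add0r (inj_eq (addIr _)) (negbTE a0).
Qed.

Definition wid (l : 'Z_k) : 'I_k.+1 := widen_ord (leqnSn k) l.

Lemma wid_inj : injective wid.
Proof. by move=> i j /(congr1 val) /= ij; apply: val_inj. Qed.

(** Reading level [n] through [twist k b n] makes the missing edges [a = 0] vertical, and a
    [level_step] can create conflicts only along these. The [2 * k] steps recolor all vertices; the
    other levels are padding. *)
Lemma strip_twisted (b : bool) (N : nat) (j : 'Z_k) : (2 * k < N)%N ->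
  exists P : nat -> 'Z_k -> 'I_k.+1,
  [/\ forall l, P 0%N l = wid l, forall l, P N l = wid (l + j),
      forall n, (n <= N)%N -> injective (P n) &
      forall n (a l : 'Z_k), (n < N)%N -> a != 0 -> a != 1 ->
        P n.+1 (a + twist k b 1 * l) <> P n l].
Proof.
move=> kN; pose tw := twist k b.
(* The factor [tw N] cancels the one through which level [N] is read. *)
pose g (l : 'Z_k) := wid (tw N * l + j).
have gi : injective g by move=> l m /wid_inj/addIr/(@twist_mulI k b).
have TC : (#|'Z_k| < #|'I_k.+1|)%N by rewrite !card_ord.
have := level_path_total TC wid_inj gi; rewrite card_ord.
move=> /(level_path_pad (N - 2 * k)%N wid_inj).
rewrite subnK ?(ltnW kN)// => /(level_path_fun wid_inj)[q [q0 qN qi qs]].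
exists (fun n l => q n (tw n * l)); split.
- by move=> l; rewrite q0 /tw twist0 mul1r.
- by move=> l; rewrite qN /g twist_mulK.
- by move=> n nN l m /(qi _ nN)/(@twist_mulI k b).
move=> n a l nN a0 _; have [_] := qs n nN; apply.
have -> : (n.+1 : int) = n%:Z + 1 by lia.
rewrite /tw twistD mulrDr -!mulrA twist_mulK eq_sym -subr_eq0 addrK.
by rewrite -{1}(mulr0 (twist k b n)) (inj_eq (@twist_mulI k b _))
  -{1}(mulr0 (twist k b 1)) (inj_eq (@twist_mulI k b _)).
Qed.

End Strips.

(** * Chromatic numbers *)

Section Chromatic.
Variable R : realType.

Lemma least_eq (P : set nat) n :
  P n -> (forall m, P m -> (n <= m)%N) -> least R P = n%:R%:E.
Proof.
move=> Pn minn; apply/eqP; rewrite eq_le; apply/andP; split.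
  by apply: ereal_inf_lbound; exists n.
by apply: le_ereal_inf_tmp => _ [m Pm <-]; rewrite lee_fin ler_nat minn.
Qed.

Lemma chi_eq (V : Type) (E : V -> V -> Prop) n :
  (exists c : V -> 'I_n, coloring E c) ->
  (forall m (c : V -> 'I_m), coloring E c -> (n <= m)%N) -> chi R E = n%:R%:E.
Proof. by move=> cn minn; apply: least_eq => // m [c /minn]. Qed.

Lemma chi_in_eq (V : Type) (M : set (set V)) (E : V -> V -> Prop) n :
  (exists2 c : V -> 'I_n, coloring E c & forall i, M (c @^-1` [set i])) ->
  (forall m (c : V -> 'I_m), coloring E c -> (forall i, M (c @^-1` [set i])) ->
    (n <= m)%N) ->
  chi_in R M E = n%:R%:E.
Proof. by move=> cn minn; apply: least_eq => // m [c /minn]; apply. Qed.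

Lemma meager0 (X : topologicalType) : meager (@set0 X).
Proof. by exists (fun=> set0) => // n; rewrite /nowhere_dense closure0 interior0. Qed.

Lemma open_baire_property (X : topologicalType) (A : set X) :
  open A -> baire_property A.
Proof. by move=> oA; exists A => //; rewrite setYK; exact: meager0. Qed.

Lemma open_borel (X : topologicalType) (A : set X) : open A -> borel_set A.
Proof. exact: sub_sigma_algebra. Qed.

Lemma borel_mu_measurable (X : ptopologicalType)
    (mu : probability (borelType X) R) (A : set X) :
  borel_set A -> mu_measurable mu A.
Proof. by move=> bA; exists A => //; rewrite setYK; exact: negligible_set0. Qed.

Lemma coloring_clique (V : Type) (E : V -> V -> Prop) n m (c : V -> 'I_m)
    (q : 'I_n -> V) :
  coloring E c -> (forall i j, i != j -> E (q i) (q j)) -> (n <= m)%N.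
Proof.
move=> cE qE; have : injective (c \o q).
  by move=> i j /= cij; apply/eqP; apply: contraT => /qE/cE.
by move=> /leq_card; rewrite !card_ord.
Qed.

End Chromatic.

(** By freeness, a base point identifies its orbit with the Cayley graph. The base points are picked
    by choice, with no regularity. *)
Lemma shift_coloring_of_cayley (G : markedGroup) K (c0 : G -> 'I_K) :
  coloring (@cayley G) c0 ->
  exists c : free_shift G -> 'I_K, coloring (@shift_graph G) c.
Proof.
move=> c0P; pose orb (x : free_shift G) := [set y | exists g : G, x = act g y].
have orbE (x : free_shift G) g : orb (act g x) = orb x.
  apply/seteqP; split=> y [h].
    by move=> /(congr1 (act g^-1%g)); rewrite actK -actM => ->; exists (g^-1 * h)%g.
  by move=> ->; rewrite -actM; exists (g * h)%g.
(* [rep] depends only on the orbit as a set, so it is constant along orbits. *)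
pose rep x := xget point (orb x).
have repP (x : free_shift G) : exists g : G, x = act g (rep x).
  by rewrite /rep; case: xgetP => [y _ //|/(_ x)]; case; exists 1%g; rewrite act1.
have [d dP] := choice repP.
exists (fun x => c0 (d x)) => x y /shift_graphP[s sG sxy]; apply: c0P.
exists s => //; apply: (@act_free _ _ _ (rep x)).
have rxy : rep y = rep x by rewrite /rep -sxy orbE.
by rewrite -{1}rxy -dP actM -dP.
Qed.

Lemma cayley_coloring_iso (G H : markedGroup) K :
  graph_iso (@cayley G) (@cayley H) ->
  (exists c : H -> 'I_K, coloring (@cayley H) c) ->
  exists c : G -> 'I_K, coloring (@cayley G) c.
Proof.
move=> [f _ fE] [c cP]; exists (c \o f) => x y /fE; exact: cP.
Qed.

Lemma graph_iso_sym (V W : Type) (E : V -> V -> Prop) (F : W -> W -> Prop) :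
  graph_iso E F -> graph_iso F E.
Proof.
move=> [f [g fK gK] fE]; exists g; first by exists f.
by move=> x y; rewrite fE !gK.
Qed.

Section TwistColorings.
Variables (k' : nat) (b : bool).
Let k := k'.+3.
Local Notation G := (@twist_marked k b isT).
Local Notation el := (@el k b).

Lemma shift_coloring_twist K (c : free_shift G -> 'I_K) :
  (forall x (i : 'Z_k), i != 0 -> c (act (el i 0) x) <> c x) ->
  (forall x (a : 'Z_k), a != 0 -> a != 1 -> c (act (el a 1) x) <> c x) ->
  coloring (@shift_graph G) c.
Proof.
move=> c0 c1.
have up (s : G) x : up_gen (s : twist_group k b) -> c (act s x) <> c x.
  case: s => i n; rewrite /up_gen /=.
  by case/orP => [/andP[/eqP-> i0]|/andP[/andP[/eqP-> i0] i1]]; [exact: c0|exact: c1].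
move=> x y /shift_graphP[s]; rewrite (mem_gens (s : twist_group k b)).
case/orP => [us <-|us <-]; first by move=> /esym; exact: up.
by have := up _ (act s x) us; rewrite actK.
Qed.

Lemma shift_coloring_el K (c : free_shift G -> 'I_K) x (i : 'Z_k) n :
  coloring (@shift_graph G) c -> el i n \in @gens k b -> c (act (el i n) x) <> c x.
Proof. by move=> cP ig /esym; apply: cP; apply/shift_graphP; exists (el i n). Qed.

Lemma shift_clique m (c : free_shift G -> 'I_m) :
  coloring (@shift_graph G) c -> (k <= m)%N.
Proof.
move=> cP; apply: (@coloring_clique _ _ k m c (fun i => act (el i 0) point) cP).
move=> i j ij; apply/shift_graphP; exists (el (j - i) 0).
  by apply: mem_gens_rot; rewrite subr_eq0 eq_sym.
by rewrite -actM elM twist0 mul1r subrK.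
Qed.

Lemma cayley_clique m (c : G -> 'I_m) : coloring (@cayley G) c -> (k <= m)%N.
Proof.
move=> cP; apply: (@coloring_clique _ _ k m c (fun i => el i 0) cP).
move=> i j ij; exists (el (j - i) 0).
  by apply: mem_gens_rot; rewrite subr_eq0 eq_sym.
by rewrite elM twist0 mul1r subrK.
Qed.

Lemma shift_coloring_succ : exists c : free_shift G -> 'I_k.+1,
  coloring (@shift_graph G) c /\ forall v, open (c @^-1` [set v]).
Proof.
have [c [oc c0 c1]] := glue_strips (@strip_twisted k' b).
by exists c; split=> //; exact: shift_coloring_twist.
Qed.

End TwistColorings.

Section DirectColorings.
Variable k' : nat.
Let k := k'.+3.
Local Notation G := (@twist_marked k false isT).

Lemma shift_coloring_direct : exists c : free_shift G -> 'I_k,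
  coloring (@shift_graph G) c /\ forall v, open (c @^-1` [set v]).
Proof.
have [c [oc c0 c1]] := glue_strips (@strip_direct k').
by exists c; split=> //; exact: shift_coloring_twist.
Qed.

Lemma cayley_coloring_direct : exists c : G -> 'I_k, coloring (@cayley G) c.
Proof.
have up (s g : twist_group k false) : up_gen s -> (s * g)%g.1 <> g.1.
  rewrite tmulE /= /twist expr0 exp1rz mul1r => us /eqP.
  rewrite -subr_eq0 addrK => /eqP s0; move: us.
  by rewrite /up_gen s0 eqxx !andbF.
exists (fun g : twist_group k false => g.1) => g h [s].
rewrite (mem_gens (s : twist_group k false)) => /orP[us ->|us ->].
  by move=> /esym; exact: up.
by have := up _ (s * g)%g us; rewrite mulKg.
Qed.

End DirectColorings.

(** * Rigidity of colorings with [k] colors *)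

Section Rigidity.
Variable k' : nat.
Let k := k'.+3.
Local Notation G := (@twist_marked k true isT).
Local Notation el := (@el k true).
Variable c : free_shift G -> 'I_k.
Hypothesis cP : coloring (@shift_graph G) c.

Definition level_coloring (x : free_shift G) (i : 'Z_k) : 'I_k := c (act (el i 0) x).
Local Notation s := level_coloring.

Lemma level_coloring_inj x : injective (s x).
Proof.
move=> i j sij; apply/eqP; apply: contraT => ij; exfalso.
apply: (@shift_coloring_el _ _ _ c (act (el j 0) x) (i - j) 0 cP).
  by apply: mem_gens_rot; rewrite subr_eq0.
by rewrite -actM elM twist0 mul1r subrK add0r.
Qed.

(* The missing edges between two consecutive levels form a single cycle of
   length [2k], which has exactly two perfect matchings. *)
Lemma level_coloring_step x :
  exists a : 'Z_k, forall j, s (act (el 0 1) x) (a - j) = s x j.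
Proof.
set y := act (el 0 1) x.
have sy_onto v : exists l, s y l = v.
  have [g _ gK] : bijective (s y) by apply: injF_bij; exact: level_coloring_inj.
  by exists (g v).
(* All [k] colors occur on the upper level, so the color of [j] recurs there, necessarily at one of
   its two non-neighbors. *)
have Hl j : exists a : 'Z_k, (a = 0 \/ a = 1) /\ s y (a - j) = s x j.
  have [l sl] := sy_onto (s x j).
  exists (l + j); rewrite addrK; split=> //.
  have [->|l0] := eqVneq (l + j) 0; first by left.
  have [->|l1] := eqVneq (l + j) 1; first by right.
  exfalso; apply: (@shift_coloring_el _ _ _ c (act (el j 0) x) (l + j) 1 cP).
    exact: mem_gens_up.
  rewrite -/(s x j) -sl /s /y -!actM !elM twist0 twist1 expr1 mulN1r addrK mulr0 addr0.
  by rewrite add0r addr0.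
(* If [a = 0] works for one vertex, it works for the next: with [a = 1] the vertex [j + 1] would
   reuse the position [-j] taken by [j]. Going around the cycle reaches every vertex. *)
have [[j0 s0]|n0] := pselect (exists j, s y (0 - j) = s x j); last first.
  exists 1 => j; have [a [[->|->//] saj]] := Hl j.
  by exfalso; apply: n0; exists j.
exists 0 => j.
suff H (n : nat) : s y (0 - (j0 + n%:R)) = s x (j0 + n%:R).
  have e : j0 + (j - j0) = j by ring.
  by have := H (j - j0); rewrite natr_Zp e.
elim: n => [|n IH]; first by rewrite addr0.
have [a [[->//|->] saj]] := Hl (j0 + n.+1%:R).
have : s y (0 - (j0 + n%:R)) = s x (j0 + n.+1%:R).
  by rewrite -saj -natr1; congr (s y _); ring.
rewrite IH => /level_coloring_inj/eqP; rewrite -natr1 addrA.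
by rewrite eq_sym -[eqbRHS]addr0 (inj_eq (addrI _)) oner_eq0.
Qed.

Lemma level_coloring_iter x (n : nat) : exists a : 'Z_k,
  forall j, s (act (el 0 n) x) (a + twist k true n * j) = s x j.
Proof.
elim: n => [|n [a IH]].
  by exists 0 => j; rewrite twist0 mul1r add0r -[el 0 _]/(1%g : twist_group k true) act1.
have [a' Ha'] := level_coloring_step (act (el 0 n) x).
exists (a' - a) => j; rewrite -IH -Ha'.
have -> : (n.+1 : int) = 1 + n%:Z by lia.
have -> : el 0 (1 + n%:Z) = (el 0 1%:Z * el 0 n%:Z)%g by rewrite elM mulr0 addr0.
rewrite actM; congr (s _ _); rewrite twistD twist1 expr1 mulN1r mulNr.
by ring.
Qed.

(** An odd number of reflections is a reflection [j -> a - j]. Were it the identity, [j = 0] would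
    give [a = 0], and [j = 1] would give [-1 = 1]. *)
Lemma level_coloring_odd x (n : nat) : odd n ->
  ~ forall i, s (act (el 0 n) x) i = s x i.
Proof.
move=> n_odd eqs; have [a Ha] := level_coloring_iter x n.
have tn : twist k true n = -1 by rewrite /twist expr1 /exprz -signr_odd n_odd.
have e j : a - j = j.
  by apply: (@level_coloring_inj x); rewrite -eqs -(Ha j) tn mulN1r.
have a0 : a = 0 by have := e 0; rewrite subr0.
have := e 1; rewrite a0 add0r; apply/eqP.
exact: Zp_opp1_neq1.
Qed.

End Rigidity.

(** * Baire category *)

Section Baire.
Variables (G : groupType) (pkl : G -> nat) (upkl : nat -> option G)
  (pklK : pcancel pkl upkl).
Implicit Types (x y z : free_shift G).

(** The full shift is not enough here: the limit must stay free. Successive finite patterns, each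
    realized by a free point, avoid one nowhere dense set and record a coordinate moved by one group
    element at a time. *)
Lemma free_shift_Baire (I : countType) (F : I -> set (free_shift G))
    (V : set (free_shift G)) :
  (forall i, nowhere_dense (F i)) -> open V -> V !=set0 ->
  exists2 y, V y & forall i, ~ F i y.
Proof.
move=> ndF /openP oV [x0 Vx0]; have [S0 HS0] := oV _ Vx0.
pose St := (seq G * free_shift G)%type.
pose Q n (p p' : St) := [/\ {subset p.1 <= p'.1}, agree p.1 p.2 p'.2,
  (forall i, unpickle n = Some i -> forall y, agree p'.1 p'.2 y -> ~ F i y) &
  (forall g, upkl n = Some g -> g != 1%g -> exists h,
     [/\ h \in p'.1, (g^-1 * h)%g \in p'.1 & val p'.2 (g^-1 * h)%g <> val p'.2 h])].
have stepF n (p : St) : exists p' : St, [/\ {subset p.1 <= p'.1}, agree p.1 p.2 p'.2 &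
    forall i, unpickle n = Some i -> forall y, agree p'.1 p'.2 y -> ~ F i y].
  case: (unpickle n) => [i|]; last by exists p; split.
  case: p => S x; have [y xy nFy] : exists2 y, agree S x y & ~ closure (F i) y.
    apply: contrapT => nex.
    have : interior (closure (F i)) x.
      rewrite /interior nbhsE; exists [set y | agree S x y].
        by split; [exact: open_agree|].
      by move=> y xy; apply: contrapT => ny; apply: nex; exists y.
    by rewrite (ndF i).
  have /openP/(_ y nFy)[S' HS'] : open (~` closure (F i)).
    exact/closed_openC/closed_closure.
  exists (S ++ S', y); split=> /=.
  - by move=> h hS; rewrite mem_cat hS.
  - by [].
  move=> _ [<-] z /agree_cat[_ /HS' nz] Fz; apply: nz; exact: subset_closure.
have step n (p : St) : exists p', Q n p p'.
  have [[S x] /= [s1 s2 s3]] := stepF n p.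
  have [[g [gn g1]]|ng] := pselect (exists g, upkl n = Some g /\ g != 1%g); last first.
    exists (S, x); split=> // g gn g1; exfalso; apply: ng; by exists g.
  have [h xh] : exists h, val x (g^-1 * h)%g <> val x h.
    apply: contrapT => nh; apply: (@free_shiftP _ x _ g1); apply/funext => h.
    by apply: contrapT => hh; apply: nh; exists h.
  exists (h :: (g^-1 * h)%g :: S, x); split=> //=.
  - by move=> u /s1 uS; rewrite !inE uS !orbT.
  - by move=> i ni y xy; apply: (s3 i ni) => u uS; apply: xy; rewrite !inE uS !orbT.
  move=> g'; rewrite gn => -[<-] _; exists h; rewrite !inE !eqxx /= orbT; split=> //.
have [st stP] := choice (fun np : nat * St => step np.1 np.2).
pose p := fix p n : St := if n is n'.+1 then st (n', p n') else (S0, x0).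
have pS n : Q n (p n) (p n.+1) by exact: (stP (n, p n)).
have mono m n : (m <= n)%N -> {subset (p m).1 <= (p n).1} /\ agree (p m).1 (p m).2 (p n).2.
  move=> /subnK <-; elim: (n - m)%N => [|d [IH1 IH2]]; first by split.
  have [s1 s2 _ _] := pS (d + m)%N; split=> [h /IH1/s1//|h hm].
  by rewrite IH2// s2// IH1.
(* The limit reads a coordinate at any stage that has fixed it; coordinates never fixed get
   [false]. *)
pose z0 : full_shift G := fun h => if pselect (exists n, h \in (p n).1) is left e
  then val (p (xget 0%N [set n | h \in (p n).1])).2 h else false.
have z0E n h : h \in (p n).1 -> z0 h = val (p n).2 h.
  move=> hn; rewrite /z0; case: pselect => [_|[]]; last by exists n.
  case: xgetP => [m _ /= hm|/(_ n)//].
  by have [mn|/ltnW nm] := leqP m n; [rewrite (mono _ _ mn).2|rewrite (mono _ _ nm).2].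
have fz : free_part z0.
  move=> g g1 gz; have [_ _ _ /(_ g (pklK g) g1)[h [h1 h2 hn]]] := pS (pkl g).
  by apply: hn; rewrite -(z0E _ _ h1) -(z0E _ _ h2) -[in RHS]gz.
pose z : free_shift G := SigSub (mem_set fz).
have zE n : agree (p n).1 (p n).2 z by move=> h hn; rewrite /= (z0E n).
exists z; first by apply: HS0; exact: (zE 0%N).
move=> i; have [_ _ /(_ i (pickleK i)) H _] := pS (pickle i).
by apply: H; exact: zE.
Qed.

Lemma nowhere_dense_preimage_act g (A : set (free_shift G)) :
  nowhere_dense A -> nowhere_dense (act g @^-1` A).
Proof.
move=> ndA; rewrite /nowhere_dense -subset0 => x.
rewrite /interior /= nbhsE => -[W [oW Wx] WA].
have : interior (closure A) (act g x); last by rewrite ndA.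
rewrite /interior nbhsE; exists (act g^-1%g @^-1` W).
  by split; [exact: open_preimage_act|rewrite /= actK].
move=> y /= /WA; rewrite -{2}(actVK g y) => H B nB.
have [|u [Au Bu]] := H (act g @^-1` B); last by exists (act g u).
move: nB; rewrite !nbhsE => -[D [oD Dy] DB].
exists (act g @^-1` D); last by move=> u; exact: DB.
by split=> //; exact: open_preimage_act.
Qed.

End Baire.

(** * Colorings of the twisted shift with the Baire property *)

Section TwistBaire.
Variables (k' : nat).
Let k := k'.+3.
Local Notation T := (twist_group k true).
Local Notation G := (@twist_marked k true isT).
Local Notation el := (@el k true).

(* A point of maximal height that is alone on its level makes the stabilizer
   trivial. *)
Lemma free_extension (S : seq T) (f : T -> bool) :
  exists x : free_shift T, forall h, h \in S -> val x h = f h.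
Proof.
pose H : nat := (\max_(h <- S) `|h.2|%N).+1.
have hS (h : T) : h \in S -> (`|h.2| < H)%N.
  by move=> hS; rewrite ltnS; exact: (@leq_bigmax_seq _ _ xpredT (fun h : T => `|h.2|%N)).
pose x : full_shift T := fun h => (h \in S) && f h || (h == el 0 H).
have xtop h : x h -> h.2 <= H%:Z.
  by move=> /orP[/andP[/hS]|/eqP->//]; lia.
have fx : free_part x.
  move=> g g1 gx; apply/negP: g1; rewrite negbK.
  have x1 : x (g * el 0 H)%g by rewrite -gx /shift_act mulKg /x eqxx orbT.
  have x2 : x (g^-1 * el 0 H)%g by rewrite -[x _]/(shift_act g x (el 0 H)) gx /x eqxx orbT.
  have := xtop _ x1; have := xtop _ x2; rewrite tinvE !tmulE /= => h1 h2.
  have g2 : g.2 = 0 by lia.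
  move: x1 => /orP[/andP[/hS]|/eqP].
    by rewrite tmulE /= g2; lia.
  by rewrite -{2}[el 0 H]mul1g => /mulIg ->.
exists (SigSub (mem_set fx)) => h hS' /=; rewrite /x hS' /=.
case: eqP => [hH|_]; last by rewrite orbF.
by have := hS _ hS'; rewrite hH /=; lia.
Qed.

Lemma baire_coloring_twisted (c : free_shift G -> 'I_k) :
  coloring (@shift_graph G) c ->
  ~ forall i, baire_property (c @^-1` [set i]).
Proof.
move=> cP bc.
have [U UP] := choice (fun i => (let: ex_intro2 U oU mU := bc i in
  ex_intro _ U (conj oU mU)) : exists U, open U /\ meager ((c @^-1` [set i]) `+` U)).
have [F FP] := choice (fun i => (let: conj _ (ex_intro2 F nF sF) := UP i in
  ex_intro _ F (conj nF sF)) : exists F : nat -> set (free_shift G),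
    (forall n, nowhere_dense (F n)) /\ (c @^-1` [set i]) `+` U i `<=` \bigcup_n F n).
pose Ix := (T * 'I_k * nat)%type.
(* Outside these countably many translates, the open sets [U i] determine the colors of the whole
   orbit. *)
pose FF (p : Ix) : set (free_shift G) := act (p.1.1 : G) @^-1` (F p.1.2 p.2).
have ndFF p : nowhere_dense (FF p).
  by apply: nowhere_dense_preimage_act; exact: (FP p.1.2).1.
have B := free_shift_Baire (@pickleK T) ndFF.
have good y : (forall p, ~ FF p y) -> forall (g : G) i,
    (c (act g y) = i <-> U i (act g y)).
  move=> ny g i.
  have : ~ ((c @^-1` [set i]) `+` U i) (act g y).
    move=> /(FP i).2 [n _ Fn]; exact: (ny (g, i, n)).
  by move=> /not_orP[/not_andP h1 /not_andP h2]; split=> H;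
    [case: h1 => // /contrapT|case: h2 => // /contrapT].
have [y0 _ ny0] := B setT openT (ex_intro _ point I).
pose s0 i := c (act (el i 0) y0).
(* At generic points, [V] says that the level coloring is [s0]. *)
pose V : set (free_shift G) := [set y | forall i : 'Z_k, U (s0 i) (act (el i 0) y)].
have oV : open V.
  rewrite openE => y Vy.
  apply: (@filter_forall _ _ (fun i => act (el i 0) @^-1` (U (s0 i))) (nbhs y)) => i.
  apply: open_nbhs_nbhs; split; last exact: Vy.
  by apply: open_preimage_act; exact: (UP (s0 i)).1.
have Vy0 : V y0 by move=> i; apply/good.
have /openP/(_ y0 Vy0)[S HS] := oV.
pose H : nat := (\max_(h <- S) `|(h : T).2|%N).+1.
have hS (h : T) : h \in S -> (`|h.2| < H)%N.
  by move=> hS; rewrite ltnS; exact: (@leq_bigmax_seq _ _ xpredT (fun h : T => `|h.2|%N)).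
(* [n] is odd, and exceeds [2 * H] so that [S] and its translate by [t^-1] are disjoint; [z] copies
   the pattern of [y0] onto both. *)
pose n := (2 * H).+1; pose t : T := el 0 n.
have [z zE] := free_extension (S ++ [seq t^-1 * h | h <- S]%g)
  (fun h => if h \in S then val y0 h else val y0 (t * h)%g).
have Vz : V z.
  by apply: HS => h hS'; rewrite zE ?mem_cat ?hS'.
have Vtz : V (act (t : G) z).
  apply: HS => h hS'; rewrite actE zE; last by rewrite mem_cat map_f ?orbT.
  rewrite ifN ?mulVKg//; apply/negP => /hS.
  by have := hS _ hS'; rewrite /= /n; lia.
have [|y [Vy Vty] ny] := B (V `&` act (t : G) @^-1` V) (openI oV (open_preimage_act _ oV)).
  by exists z.
apply: (@level_coloring_odd k' c cP y n); first by rewrite /n mul2n /= odd_double.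
move=> i; rewrite /level_coloring.
have -> : c (act (el i 0) y) = s0 i by apply/good.
by rewrite -actM; apply/good => //; rewrite actM; exact: Vty.
Qed.

End TwistBaire.

(** * Irrational rotations *)

Section Rotation.
Variable R : realType.

Definition incommensurable (a : R) :=
  forall n p : int, n != 0 -> n%:~R * a + p%:~R != 0.

Lemma incommensurable_pi : incommensurable (pi : R).
Proof.
move=> n p n0; apply/eqP => e; apply: (@pi_irrationnal R).
exists ((- p)%:~R / n%:~R) => //; rewrite fmorph_div /= !ratr_int.
apply: (@mulfI _ n%:~R); first by rewrite intr_eq0.
by rewrite mulrC divfK ?intr_eq0// rmorphN; apply/esym/eqP; rewrite -addr_eq0 e.
Qed.

Lemma incommensurableM2 (a : R) : incommensurable a -> incommensurable (2 * a).
Proof.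
move=> ia n p n0; have -> : n%:~R * (2 * a) = (n * 2)%:~R * a.
  by rewrite rmorphM /= mulrA.
by apply: ia; rewrite mulf_neq0.
Qed.

(* Euclidean division of 1 by an element g of the subgroup produces a
   remainder r; one of r and g - r is at most g / 2. *)
Lemma incommensurable_small (a : R) : incommensurable a -> forall m : nat,
  exists n p : int, n != 0 /\ 0 < n%:~R * a + p%:~R <= 2^-1 ^+ m.
Proof.
move=> ia; elim=> [|m [n [p [n0 /andP[g0 gm]]]]].
  exists 1, (- Num.floor a); split=> //; rewrite rmorph1 mul1r rmorphN /= expr0.
  have /andP[fa af] := floor_itv a; rewrite intrD in af.
  have := ia 1 (- Num.floor a) isT; rewrite rmorph1 mul1r rmorphN /= => ne.
  by rewrite lt_neqAle eq_sym ne /=; lra.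
set g := n%:~R * a + p%:~R in g0 gm.
have g1 : g <= 1 by rewrite (le_trans gm)// exprn_ile1//; lra.
pose q := Num.floor g^-1.
have /andP[qg gq] := floor_itv g^-1; rewrite -/q intrD in qg gq.
have q1 : 1 <= q by rewrite /q floor_ge_int invf_ge1.
pose r := 1 - q%:~R * g.
have r0 : 0 <= r by rewrite subr_ge0 -ler_pdivlMr// mul1r.
have rg : r < g.
  move: gq; rewrite -(ltr_pM2r g0) mulVf ?gt_eqF// mulrDl mul1r /r; lra.
have rE : r = (- (q * n))%:~R * a + (1 - q * p)%:~R.
  by rewrite /r /g !(rmorphN, rmorphB, rmorphM, rmorph1) /=; ring.
have grE : g - r = ((1 + q) * n)%:~R * a + ((1 + q) * p - 1)%:~R.
  by rewrite /r /g !(rmorphN, rmorphB, rmorphM, rmorphD, rmorph1) /=; ring.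
have [rs|rs] := leP r (g / 2).
  exists (- (q * n)), (1 - q * p).
  have qn : - (q * n) != 0 by rewrite oppr_eq0 mulf_neq0//; lia.
  split=> //; rewrite -rE lt_neqAle eq_sym r0 {1}rE ia//=.
  by rewrite exprS; lra.
exists ((1 + q) * n), ((1 + q) * p - 1); split.
  by rewrite mulf_neq0//; lia.
by rewrite -grE exprS; apply/andP; split; lra.
Qed.

(** The subgroup generated by [a] and 1 has a positive element [g] shorter than the interval; its
    first multiple beyond [u] lies below [v]. *)
Lemma incommensurable_dense (a u v : R) : incommensurable a -> u < v ->
  exists n p : int, u < n%:~R * a + p%:~R < v.
Proof.
move=> ia uv.
have [m mv] : exists m : nat, 2^-1 ^+ m < v - u :> R.
  have [m _ Hm] := @near_infty_natSinv_expn_lt R (PosNum (ltac:(by rewrite subr_gt0) : 0 < v - u)).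
  exists m; have := Hm m (leqnn m); rewrite /= => h.
  by rewrite exprVn -div1r.
have [n [p [_ /andP[]]]] := incommensurable_small ia m.
set g := n%:~R * a + _ => g0 gm.
have gv : g < v - u by exact: le_lt_trans gm mv.
have /andP[fu uf] := floor_itv (u / g); set q := Num.floor (u / g) in fu uf.
have h1 : u < (q + 1)%:~R * g by rewrite -ltr_pdivrMr.
have h2 : q%:~R * g <= u by rewrite -ler_pdivlMr.
exists ((q + 1) * n), ((q + 1) * p).
have -> : ((q + 1) * n)%:~R * a + ((q + 1) * p)%:~R = (q + 1)%:~R * g.
  by rewrite /g !(rmorphM) /=; ring.
by rewrite h1 /= intrD mulrDl mul1r; lra.
Qed.

(** Density for [2 * a] puts some [m * (2 * a) + p] close to [- a]; adding [a] gives an odd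
    multiple, and a sign change makes it nonnegative. *)
Lemma incommensurable_odd (a d : R) : incommensurable a -> 0 < d ->
  exists (n : nat) (p : int), odd n /\ `|n%:R * a + p%:~R| < d.
Proof.
move=> ia d0.
have [m [p /andP[h1 h2]]] := @incommensurable_dense _ (- a - d) (- a + d)
  (incommensurableM2 ia) (ltac:(lra)).
have [m0|m0] := leP 0 m.
  exists (absz (2 * m + 1)), p; split; first by lia.
  have -> : (absz (2 * m + 1))%:R = (2 * m + 1)%:~R :> R.
    by rewrite natr_absz; congr (_ %:~R); lia.
  by rewrite rmorphD rmorphM rmorph1 /= ltr_norml; apply/andP; split; lra.
exists (absz (2 * m + 1)), (- p); split; first by lia.
have -> : (absz (2 * m + 1))%:R = (- (2 * m + 1))%:~R :> R.
  by rewrite natr_absz; congr (_ %:~R); lia.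
by rewrite !rmorphN rmorphD rmorphM rmorph1 /= ltr_norml; apply/andP; split; lra.
Qed.

End Rotation.

(** * A theorem of Steinhaus *)

Section Steinhaus.
Variable R : realType.
Local Notation mu := (@lebesgue_measure R).

Definition translate (d x : R) : R := x + d.

Lemma measurable_translate (d : R) : measurable_fun setT (translate d).
Proof. by apply: measurable_funD => //; exact: measurable_cst. Qed.

Lemma lebesgue_measure_translate (d : R) (A : set R) : measurable A ->
  mu (translate d @^-1` A) = mu A.
Proof.
move=> mA.
rewrite -[LHS]/(pushforward mu (translate d : _ -> measurableTypeR R) A).
apply/esym/lebesgue_measure_unique => //=; first exact: measurable_translate.
move=> _ _ [[a b]] _ <-.
rewrite /pushforward /=.
have -> : translate d @^-1` [set` `]a, b]] = [set` `]a - d, b - d]].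
  by apply/seteqP; split=> x /=; rewrite !in_itv /= /translate ltrBlDr lerBrDr.
rewrite !lebesgue_measure_itv /= !lte_fin ltrD2r; case: ifP => // _.
by rewrite -!EFinB; congr EFin; lra.
Qed.

(** Take a compact [K] in [E] of positive measure and an open [U] around it of measure less than
    twice that of [K]. Small translates of [K] stay inside [U], hence cannot be disjoint from
    [K]. *)
Lemma steinhaus (E : set R) : measurable E -> (mu E < +oo)%E -> (0 < mu E)%E ->
  exists2 d0 : R, 0 < d0 & forall d, `|d| < d0 -> exists x, E x /\ E (x + d).
Proof.
move=> mE Eoo E0.
have finE : mu E \is a fin_num by rewrite ge0_fin_numE// ltW.
(* With tolerance [mu E] itself, [K] cannot be null; the tolerance [mu K] for [U] below gives the
   factor two. *)
have [K [cK KE EK]] := lebesgue_regularity_inner mE Eoo (fine_gt0 (introT andP (conj E0 Eoo))).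
have mK : measurable K.
  by apply: closed_measurable; apply: compact_closed => //; exact: Rhausdorff.
have Koo : (mu K < +oo)%E by apply: le_lt_trans Eoo; apply: le_measure; rewrite ?inE.
have K0 : (0 < mu K)%E.
  rewrite lt_neqAle measure_ge0 andbT; apply/eqP => /esym K0.
  have eK : (mu (E `\` K) = mu E - mu K)%E by rewrite measureD// setIidr.
  have : (mu (E `\` K) < mu E)%E by rewrite -[X in (_ < X)%E]fineK.
  by rewrite eK K0 sube0 ltxx.
have finK : mu K \is a fin_num by rewrite ge0_fin_numE// ltW.
have [U [oU KU UK]] := lebesgue_regularity_outer mK Koo (fine_gt0 (introT andP (conj K0 Koo))).
rewrite fineK// in UK.
have mU : measurable U by exact: open_measurable.
have : \forall d \near (0 : R), K `<=` (fun x => U (x - d)).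
  move: cK => /compact_near_coveringP /(_ R (nbhs (0 : R)) (fun d x => U (x - d))); apply.
  move=> x Kx.
  have cont : (fun z : R * R => z.1 - z.2) @ (x, 0 : R) --> x - 0.
    by apply: cvgB; [exact: cvg_fst|exact: cvg_snd].
  rewrite subr0 in cont; apply: cont.
  by apply: open_nbhs_nbhs; split=> //; exact: KU.
move=> /nbhs_ballP[d0 /= d00 Hd]; exists d0 => // d dd0.
have KdU : translate d @^-1` K `<=` U.
  move=> x Kx; have := Hd d; rewrite /ball /= sub0r normrN => /(_ dd0 _ Kx).
  by rewrite /translate addrK.
apply: contrapT => nx.
have dis : K `&` translate d @^-1` K = set0.
  apply/seteqP; split=> // x [Kx Kdx]; apply: nx; exists x; split; exact: KE.
have mKd : measurable (translate d @^-1` K).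
  by rewrite -[X in measurable X]setTI; exact: measurable_translate.
have : (mu (K `|` translate d @^-1` K) <= mu U)%E.
  by apply: le_measure; rewrite ?inE//; [exact: measurableU|rewrite subUset].
have -> : (mu (K `|` translate d @^-1` K) = mu K + mu K)%E.
  by rewrite measureU//; congr (_ + _)%E; exact: lebesgue_measure_translate.
have -> : (mu U = mu K + mu (U `\` K))%E.
  rewrite -{1}(setDUK KU) measureU//; first exact: measurableD.
  by rewrite setDE setICA setICr setI0.
by rewrite leeD2lE// leNgt UK.
Qed.

End Steinhaus.

(** * A measure without measurable [k]-colorings *)

Section FreeShiftMeasurable.
Variables (R : realType) (G : groupType) (pkl : seq (G * bool) -> nat)
  (upkl : nat -> option (seq (G * bool))) (pklK : pcancel pkl upkl).

(** An open set is the union of the cylinders it contains, and there are only countably many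
    cylinders. *)
Lemma measurable_to_free_shift (f : R -> free_shift G) :
  (forall h v, measurable [set u : R | val (f u) h = v]) ->
  measurable_fun setT (f : R -> borelType (free_shift G)).
Proof.
move=> mf; apply: (@measurability _ _ _ (borelType (free_shift G)) _ _ open) => //.
move=> _ [A oA <-]; rewrite setTI.
pose cyl (p : seq (G * bool)) : set (free_shift G) := [set x | forall hv, hv \in p -> val x hv.1 = hv.2].
pose D n := if upkl n is Some p then
  (if pselect (cyl p `<=` A) is left _ then f @^-1` cyl p else set0) else set0.
have -> : f @^-1` A = \bigcup_n D n.
  apply/seteqP; split=> u /=.
    move=> Au; have /openP/(_ _ Au)[S SA] := oA.
    pose p := [seq (h, val (f u) h) | h <- S].
    have pA : cyl p `<=` A.
      by move=> y py; apply: SA => h hS; rewrite (py (h, val (f u) h))//; exact: map_f.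
    exists (pkl p) => //; rewrite /D pklK; case: pselect => // _.
    by move=> _ /mapP[h hS ->].
  by move=> [n _]; rewrite /D; case: (upkl n) => // p; case: pselect => // pA /pA.
apply: bigcupT_measurable => n; rewrite /D; case: (upkl n) => // p.
case: pselect => // _; elim: p => [|[h v] p IH].
  suff -> : f @^-1` cyl [::] = setT by exact: measurableT.
  by apply/seteqP; split.
suff -> : f @^-1` cyl ((h, v) :: p) = [set u : R | val (f u) h = v] `&` f @^-1` cyl p.
  exact: measurableI.
apply/seteqP; split=> u /= => [H|[H1 H2] hv].
  by split=> [|hv hp]; [apply: (H (h, v)); rewrite mem_head|
    apply: H; rewrite inE hp orbT].
by rewrite inE => /orP[/eqP->|/H2].
Qed.

End FreeShiftMeasurable.

(** * Coding the rotation of the circle into the free part *)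

Section Coding.
Variables (R : realType) (k' : nat) (b : bool) (a : R).
Hypothesis ia : incommensurable a.
Let k := k'.+3.
Local Notation T := (twist_group k b).
Local Notation el := (@el k b).
Local Notation tw := (twist k b).

Definition half_circle (u : R) := `[< exists p : int, p%:~R <= u < p%:~R + 2^-1 >].

Lemma half_circleD u (p : int) : half_circle (u + p%:~R) = half_circle u.
Proof.
apply/asboolP/asboolP => -[q hq]; [exists (q - p)|exists (q + p)];
  by rewrite ?rmorphB ?rmorphD /=; lra.
Qed.

Lemma half_circle_in u : 0 < u < 2^-1 -> half_circle u.
Proof. by move=> hu; apply/asboolP; exists 0; rewrite rmorph0; lra. Qed.

Lemma half_circle_out u : 2^-1 < u < 1 -> ~~ half_circle u.
Proof.
move=> hu; apply/asboolPn => -[p hp].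
have : (p%:~R < (1 : int)%:~R :> R) by rewrite rmorph1; lra.
have : ((0 : int)%:~R < p%:~R :> R) by rewrite rmorph0; lra.
by rewrite !ltr_int; lia.
Qed.

(** The arc and its translate by a non-integer [d] differ on a whole interval, which the dense orbit
    of [u] enters modulo 1. *)
Lemma half_circle_aperiodic (u d : R) : (forall p : int, d != p%:~R) ->
  exists n : int, half_circle (u + n%:~R * a) != half_circle (u + n%:~R * a + d).
Proof.
move=> dZ; pose e := d - (Num.floor d)%:~R.
have /andP[fd df] := floor_itv d; rewrite intrD in df.
have e0 : 0 < e.
  by rewrite subr_gt0 lt_neqAle fd andbT eq_sym dZ.
have e1 : e < 1 by rewrite /e; move: df; rewrite rmorph1; lra.
have [lo [hi [lohi Hin]]] : exists lo hi, lo < hi /\ forall v, lo < v < hi ->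
    half_circle v != half_circle (v + e).
  have [e2|e2] := leP e 2^-1.
    exists (2^-1 - e), 2^-1; split=> [|v hv]; first by lra.
    by rewrite (half_circle_in (u := v)) ?(negbTE (half_circle_out _))//; lra.
  exists 0, (1 - e); split=> [|v hv]; first by lra.
  by rewrite (half_circle_in (u := v)) ?(negbTE (half_circle_out _))//; lra.
have [n [p hnp]] := incommensurable_dense ia (ltac:(lra) : lo - u < hi - u).
exists n; have := Hin (u + n%:~R * a + p%:~R) (ltac:(lra)).
rewrite half_circleD.
have -> : u + n%:~R * a + p%:~R + e = u + n%:~R * a + d + (p - Num.floor d)%:~R.
  by rewrite /e rmorphB /=; lra.
by rewrite half_circleD.
Qed.

(** The column [i] carries the itinerary of [u] under the rotation by [a], so [t] acts by rotating
    [u] while the rotations [r^j] move the column. *)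
Definition code_fun (u : R) (i : 'Z_k) : full_shift T :=
  fun h => (h.1 == i) && half_circle (u - h.2%:~R * a).

Lemma code_fun_act j m u i :
  shift_act (el j m) (code_fun u i) = code_fun (u + m%:~R * a) (tw m * i + j).
Proof.
apply/funext => -[l n]; rewrite /shift_act /code_fun elV -[(l, n)]/(el l n) elM /=.
congr (_ && half_circle _); last by rewrite rmorphD rmorphN /=; ring.
rewrite twistN -mulrN -mulrDr -(inj_eq (@twist_mulI k b m)) twist_mulK.
by rewrite addrC subr_eq.
Qed.

(** The only nonempty column must be preserved, and aperiodicity of the itinerary forces height
    0. *)
Lemma code_fun_free u i : free_part (code_fun u i).
Proof.
move=> [j m] g1; rewrite -[(j, m)]/(el j m) code_fun_act => e.
have e' l n : (l == tw m * i + j) && half_circle (u + m%:~R * a - n%:~R * a) =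
    (l == i) && half_circle (u - n%:~R * a) by exact: (congr1 (@^~ (el l n)) e).
have hex w : exists n : int, half_circle (w - n%:~R * a).
  have [n [p hnp]] := incommensurable_dense ia (ltac:(lra) : - w < 2^-1 - w).
  exists (- n); rewrite -(half_circleD _ p); apply: half_circle_in.
  by rewrite rmorphN /=; lra.
have ij : i = tw m * i + j.
  have [n hn] := hex u; have := e' i n; rewrite eqxx hn /=.
  by case/andP => /eqP.
have m0 : m = 0.
  apply/eqP; apply: contraT => m0.
  have [p|n] := @half_circle_aperiodic u (m%:~R * a).
    have := ia (- p) m0; apply: contra => /eqP->.
    by rewrite rmorphN addrN.
  have := e' i (- n); rewrite -ij eqxx /= rmorphN /=.
  by rewrite mulNr opprK addrAC => ->; rewrite eqxx.
move: ij g1; rewrite m0 twist0 mul1r => /eqP; rewrite addrC -subr_eq subrr eq_sym.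
by move=> /eqP ->; rewrite eqxx.
Qed.

Definition code (u : R) (i : 'Z_k) : free_shift T :=
  SigSub (mem_set (@code_fun_free u i)).

Lemma code_act j m u i :
  act (el j m) (code u i) = code (u + m%:~R * a) (tw m * i + j).
Proof. by apply: val_inj; rewrite /= code_fun_act. Qed.

Lemma codeD u i (p : int) : code (u + p%:~R) i = code u i.
Proof.
apply: val_inj; apply/funext => h /=; rewrite /code_fun.
by rewrite addrAC half_circleD.
Qed.

(* The interval [i, i + 1) carries the points of the column [i]. *)
Definition line_code (u : R) : free_shift T := code u (Num.floor u)%:~R.

Lemma line_codeE u (i : 'Z_k) : 0 <= u < 1 ->
  line_code (u + (i : nat)%:R) = act (el i 0) (code u 0).
Proof.
move=> u01; rewrite code_act mulr0 add0r rmorph0 mul0r addr0 /line_code.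
have -> : Num.floor (u + (i : nat)%:R) = (i : nat) :> int.
  by apply: floor_def; rewrite intrD rmorph1 -pmulrn; lra.
by rewrite -pmulrn natr_Zp pmulrn codeD.
Qed.

Lemma measurable_line_code :
  measurable_fun setT (line_code : R -> borelType (free_shift T)).
Proof.
apply: (measurable_to_free_shift (@pickleK (seq (T * bool)))) => -[i n] v.
suff mt : measurable [set u : R | val (line_code u) (i, n)].
  case: v => //.
  suff -> : [set u | val (line_code u) (i, n) = false] =
      ~` [set u : R | val (line_code u) (i, n)] by exact: measurableC.
  by apply/seteqP; split=> u /= => [->//|/negP/negbTE].
have -> : [set u : R | val (line_code u) (i, n)] =
    (\bigcup_(m : int) if i == m%:~R then [set` `[m%:~R, m%:~R + 1[] else set0) `&`
    (\bigcup_(p : int) [set` `[p%:~R + n%:~R * a, p%:~R + n%:~R * a + 2^-1[]).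
  apply/seteqP; split=> u /=.
    rewrite /line_code /= /code_fun /= => /andP[/eqP iu /asboolP[p hp]]; split.
      exists (Num.floor u) => //; rewrite iu eqxx /= in_itv /=.
      by have := floor_itv u; rewrite intrD rmorph1.
    by exists p => //=; rewrite in_itv /=; lra.
  move=> [[m _] hm [p _ /=]]; rewrite in_itv /= => hp.
  move: hm; case: eqP => //= im; rewrite in_itv /= => hm.
  rewrite /line_code /= /code_fun /=.
  have -> : Num.floor u = m by apply: floor_def; rewrite intrD rmorph1.
  by rewrite im eqxx /=; apply/asboolP; exists p; lra.
apply: measurableI; apply: countable_bigcupT_measurable => //= m.
by case: ifP.
Qed.

End Coding.

Section NoMeasurableColoring.
Variables (R : realType) (k' : nat).
Let k := k'.+3.
Local Notation G := (@twist_marked k true isT).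
Local Notation X := (free_shift G).
Local Notation lam := (@lebesgue_measure R).
Let a : R := pi.
Let ia : incommensurable a := @incommensurable_pi R.

Let k0 : (0 : R) < k%:R. Proof. by rewrite ltr0n. Qed.

Lemma uniform_prob_eq0 (A : set R) : measurable A -> uniform_prob k0 A = 0%E ->
  lam (A `&` `[0, k%:R]) = 0%E.
Proof.
move=> mA; rewrite /uniform_prob integral_uniform_pdf.
have mAk : measurable (A `&` `[0, k%:R]%classic) by exact: measurableI.
rewrite (eq_integral (fun=> (k%:R)^-1%:E)); last first.
  move=> x; rewrite inE /= => -[_]; rewrite in_itv /= /uniform_pdf subr0 => ->.
  by [].
rewrite integral_cst//= => /eqP; rewrite mule_eq0 => /orP[|/eqP//].
by rewrite eqe invr_eq0 gt_eqF.
Qed.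

(** The measure is the image of the uniform law on [[0, k]] under [line_code], so null sets are
    controlled on all columns at once. *)
Lemma no_measurable_coloring : exists mu : probability (borelType X) R,
  forall c : X -> 'I_k, coloring (@shift_graph G) c ->
  ~ forall i, mu_measurable mu (c @^-1` [set i]).
Proof.
pose psi := @line_code R k' true a ia.
have mpsi : measurable_fun setT (psi : R -> borelType X) by exact: measurable_line_code.
pose X0 : {mfun (measurableTypeR R) >-> (borelType X)} :=
  @mfun_Sub _ _ (measurableTypeR R) (borelType X) psi (mem_set mpsi).
exists (distribution (uniform_prob k0) X0) => c cP mc.
have [B BP] := choice (fun i => (let: ex_intro2 B bB nB := mc i in
  ex_intro _ B (conj bB nB)) : exists B, borel_set B /\
    (distribution (uniform_prob k0) X0).-negligible ((c @^-1` [set i]) `+` B)).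
have [N NP] := choice (fun i => (let: conj _ nB := BP i in nB) :
  exists N : set (borelType X), [/\ measurable N,
    distribution (uniform_prob k0) X0 N = 0%E & (c @^-1` [set i]) `+` B i `<=` N]).
have mB i : measurable (psi @^-1` B i).
  by rewrite -[X in measurable X]setTI; apply: (mpsi) => //; exact: (BP i).1.
have mN i : measurable (psi @^-1` N i).
  by rewrite -[X in measurable X]setTI; apply: (mpsi) => //; case: (NP i).
have N0 i : lam (psi @^-1` N i `&` `[0, k%:R]) = 0%E.
  by apply: uniform_prob_eq0 => //; case: (NP i).
pose Z (j : 'Z_k) i : set R :=
  translate (j : nat)%:R @^-1` (psi @^-1` N i `&` `[0, k%:R]).
have mtr d (A : set R) : measurable A -> measurable (translate d @^-1` A).
  by move=> mA; rewrite -[X in measurable X]setTI; exact: measurable_translate.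
have Z0 j i : lam.-negligible (Z j i).
  have mA : measurable (psi @^-1` N i `&` `[0, k%:R]) by exact: measurableI.
  apply/negligibleP; first exact: mtr.
  by have := lebesgue_measure_translate (j : nat)%:R mA; rewrite N0.
(* On [E s] the level coloring is [s]. Using the Borel sets [B] and [N] in place of the color
   classes makes [E s] measurable. *)
pose E (s : {ffun 'Z_k -> 'I_k}) : set R := `[0, 1[ `&`
  \big[setI/setT]_(j : 'Z_k) (translate (j : nat)%:R @^-1`
    (psi @^-1` B (s j) `\` psi @^-1` N (s j))).
have mE s : measurable (E s).
  apply: measurableI => //; apply: bigsetI_measurable => j _; apply: mtr.
  exact: measurableD.
pose y u : X := @code R k' true a ia u 0.
have EP s u : E s u -> 0 <= u < 1 /\
    forall j, level_coloring c (y u) j = s j.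
  move=> [/=]; rewrite in_itv /= => u01 Eu; split=> // j.
  rewrite /level_coloring /y -line_codeE//; apply: contrapT => nc.
  move: Eu; rewrite -bigcap_seq => /(_ j); rewrite /= mem_index_enum => /(_ isT) [Bu Nu].
  have [_ _ sub] := NP (s j); apply: Nu; apply: sub; right; split=> //.
have cover : `[0, 1[%classic `<=` \big[setU/set0]_s E s `|`
    \big[setU/set0]_(j : 'Z_k) \big[setU/set0]_(i : 'I_k) Z j i.
  move=> u u01; apply: contrapT => /not_orP[nE nZ].
  apply: nE; pose s := [ffun j : 'Z_k => c (psi (translate (j : nat)%:R u))].
  rewrite -bigcup_seq; exists s; first by rewrite /= mem_index_enum.
  split=> //; rewrite -bigcap_seq => j _ /=.
  have nN : ~ N (s j) (psi (translate (j : nat)%:R u)).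
    move=> Nu; apply: nZ; rewrite -bigcup_seq; exists j; first by rewrite /= mem_index_enum.
    rewrite -bigcup_seq; exists (s j); first by rewrite /= mem_index_enum.
    split=> //=; rewrite /translate in_itv /=; move: u01; rewrite /= in_itv /= => u01.
    have : (j.+1%:R <= k%:R :> R) by rewrite ler_nat; exact: ltn_ord.
    have : (0 <= (j : nat)%:R :> R) by exact: ler0n.
    by rewrite -natr1; lra.
  split=> //; have [_ _ sub] := NP (s j); apply: contrapT => nB; apply: nN; apply: sub.
  by left; split=> //=; rewrite /s ffunE.
(* The finitely many sets [E s] cover [[0, 1)] up to null sets. *)
have [s Es] : exists s, (0 < lam (E s))%E.
  apply: contrapT => nE.
  have E0 s : lam.-negligible (E s).
    apply/negligibleP; first exact: mE.
    apply: contrapT => Es; apply: nE; exists s.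
    by rewrite lt_neqAle measure_ge0 andbT eq_sym; apply/eqP.
  have : lam.-negligible `[0, 1[%classic.
    apply: negligibleS; first exact: cover.
    apply: negligibleU.
      by elim/big_ind : _ => //; [exact: negligible_set0|move=> *; exact: negligibleU].
    elim/big_ind : _ => //; [exact: negligible_set0|by move=> *; exact: negligibleU|].
    move=> j _.
    by elim/big_ind : _ => //; [exact: negligible_set0|move=> *; exact: negligibleU].
  move=> /measure_negligible => /(_ (measurable_itv _)) l0.
  have : lam `[0, 1[%classic = 0%E by exact: l0.
  by rewrite lebesgue_measure_itv /= lte01 sube0 => /eqP; rewrite onee_eq0.
have Eoo : (lam (E s) < +oo)%E.
  apply: (@le_lt_trans _ _ (lam `[0, 1[%classic)).
    apply: le_measure; rewrite ?inE; [exact: mE|exact: measurable_itv|].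
    exact: subIsetl.
  by rewrite lebesgue_measure_itv /= lte01 sube0 ltry.
have [d0 d00 Hd] := steinhaus (mE s) Eoo Es.
have [n [p [n_odd /Hd[u [Eu Eud]]]]] := incommensurable_odd ia d00.
have [_ s1] := EP _ _ Eu; have [_ s2] := EP _ _ Eud.
apply: (@level_coloring_odd k' c cP (y u) n n_odd) => j.
rewrite s1 -(s2 j) /y code_act mulr0 addr0; congr (level_coloring c _ j).
by rewrite -pmulrn addrA codeD.
Qed.

End NoMeasurableColoring.

(** * Computation of the chromatic numbers *)

Theorem theorem10 (R : realType) (k : nat) (hk : (3 <= k)%N) :
  exists Gamma Delta : markedGroup,
    [/\ graph_iso (@cayley Gamma) (@cayley Delta),
        [/\ chi_B R (@shift_graph Gamma) = (k%:R%:E)%R,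
            chi_BM R (@shift_graph Gamma) = (k%:R%:E)%R,
            chi_M R (@shift_graph Gamma) = (k%:R%:E)%R &
            [/\ chi R (@shift_graph Gamma) = (k%:R%:E)%R,
                chi R (@shift_graph Delta) = (k%:R%:E)%R,
                chi R (@cayley Gamma) = (k%:R%:E)%R &
                chi R (@cayley Delta) = (k%:R%:E)%R]] &
        [/\ chi_B R (@shift_graph Delta) = (k.+1%:R%:E)%R,
            chi_BM R (@shift_graph Delta) = (k.+1%:R%:E)%R &
            chi_M R (@shift_graph Delta) = (k.+1%:R%:E)%R]].
Proof.
case: k hk => [|[|[|k']]]// _.
set k := k'.+3; pose Gam := @twist_marked k false isT; pose Del := @twist_marked k true isT.
have iso : graph_iso (@cayley Gam) (@cayley Del) by exact: cayley_iso.
have [c [cP oc]] : exists c : free_shift Gam -> 'I_k,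
    coloring (@shift_graph Gam) c /\ forall v, open (c @^-1` [set v]).
  exact: shift_coloring_direct.
have [c' [c'P oc']] : exists c : free_shift Del -> 'I_k.+1,
    coloring (@shift_graph Del) c /\ forall v, open (c @^-1` [set v]).
  exact: shift_coloring_succ.
have cayG : exists c : Gam -> 'I_k, coloring (@cayley Gam) c.
  exact: cayley_coloring_direct.
have cayD : exists c : Del -> 'I_k, coloring (@cayley Del) c.
  exact: cayley_coloring_iso (graph_iso_sym iso) cayG.
(* A coloring with open classes serves every regularity class containing the open sets, and cliques
   give the lower bound. *)
have chiG (M : set (set (free_shift Gam))) :
    (forall A, open A -> M A) -> chi_in R M (@shift_graph Gam) = k%:R%:E.
  move=> oM; apply: chi_in_eq; first by exists c => // i; exact/oM/oc.
  by move=> m d dP _; exact: shift_clique dP.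
have chiD (M : set (set (free_shift Del))) : (forall A, open A -> M A) ->
    (forall d : free_shift Del -> 'I_k, coloring (@shift_graph Del) d ->
       ~ forall i, M (d @^-1` [set i])) ->
    chi_in R M (@shift_graph Del) = k.+1%:R%:E.
  move=> oM nM; apply: chi_in_eq; first by exists c' => // i; exact/oM/oc'.
  move=> m d dP dM; have := shift_clique dP; rewrite leq_eqVlt => /orP[/eqP km|//].
  by case: m / km d dP dM => d dP /(nM d dP).
have open_mu (G : groupType) (mu : probability (borelType (free_shift G)) R) A :
    open A -> mu_measurable mu A.
  by move=> oA; exact: (@borel_mu_measurable R _ mu A (open_borel oA)).
have [mu muP] : exists mu : probability (borelType (free_shift Del)) R,
    forall d : free_shift Del -> 'I_k, coloring (@shift_graph Del) d ->
    ~ forall i, mu_measurable mu (d @^-1` [set i]).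
  exact: no_measurable_coloring.
exists Gam, Del; split=> //.
- split.
  + by apply: chiG => A; exact: open_borel.
  + by apply: chiG => A; exact: open_baire_property.
  + rewrite /chi_M [X in ereal_sup X](_ : _ = [set k%:R%:E]) ?ereal_sup1//.
    apply/seteqP; split=> [_ [nu _ <-]|_ ->]; first exact/chiG/open_mu.
    (* A Dirac measure shows that the supremum is not over the empty set. *)
    by exists (dirac point) => //; exact/chiG/open_mu.
  split.
  + by apply: chi_eq; [exists c|move=> m d; exact: shift_clique].
  + apply: chi_eq; last by move=> m d; exact: shift_clique.
    by have [d /shift_coloring_of_cayley] := cayD.
  + by apply: chi_eq => // m d; exact: cayley_clique.
  + by apply: chi_eq => // m d; exact: cayley_clique.
split.
(* A Borel [k]-coloring would be measurable for the measure [mu]. *)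
- apply: chiD => [A|d dP dM]; first exact: open_borel.
  by apply: (muP d dP) => i; exact: (@borel_mu_measurable R (free_shift Del) mu _ (dM i)).
- apply: chiD => [A|]; first exact: open_baire_property.
  exact: baire_coloring_twisted.
apply/eqP; rewrite eq_le; apply/andP; split.
  apply: ge_ereal_sup => _ [nu _ <-].
  by apply: ereal_inf_lbound; exists k.+1 => //; exists c' => // i; exact/open_mu/oc'.
by apply: ereal_sup_ubound; exists mu => //; apply: chiD => //; exact: open_mu.
Qed.
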